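(* Let $(X,\varphi)$ be a Cantor minimal system. Then there exist involutions $i_1,i_2,i_3\in[\varphi]$ with clopen supports such that $\varphi=i_1i_2i_3$.
   Context: A Cantor set is a (non-empty) zero-dimensional compact metric space without isolated points. $H(X)$ is the group of all homeomorphisms of $X$. A Cantor minimal system $(X,\varphi)$ is a Cantor set $X$ with $\varphi\in H(X)$ such that every orbit $Orb_\varphi(x)=\{\varphi^n(x):n\in\mathbb Z\}$ is dense in $X$. The full group $[\varphi]$ is the set of all $f\in H(X)$ with $f(x)\in Orb_\varphi(x)$ for all $x\in X$. The support of $f\in H(X)$ is $supp(f)=\{x\in X:f(x)\neq x\}$. An involution is an element $g$ with $g^2=id$. *)

(* Defs.v *)
From HB Require Import structures.
From mathcomp Require Import all_boot all_order all_algebra.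
From mathcomp Require Import all_classical all_reals.
From mathcomp Require Import topology.

Set Implicit Arguments.
Unset Strict Implicit.
Unset Printing Implicit Defensive.

Local Open Scope classical_set_scope.

(* For compact Hausdorff spaces the library's [zero_dimensional] (clopen sets
   separate points) amounts to the existence of a base of clopen sets, see
   [zero_dimensional_cvg]. *)
Definition Cantor_set (R : realType) (X : metricType R) : Prop :=
  [/\ [set: X] !=set0, zero_dimensional X, compact [set: X]
    & isolated [set: X] = set0].

Record homeo (X : topologicalType) : Type := Homeo {
  homeo_fun :> X -> X;
  homeo_inv : X -> X;
  homeo_funK : cancel homeo_fun homeo_inv;
  homeo_invK : cancel homeo_inv homeo_fun;
  homeo_fun_continuous : continuous homeo_fun;
  homeo_inv_continuous : continuous homeo_inv }.

Section HomeoGroup.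
Variable X : topologicalType.
Implicit Types f g h : homeo X.

Lemma homeoP f g : f =1 g -> f = g.
Proof.
case: f g => [f f' fK f'K fc f'c] [g g' gK g'K gc g'c] /= /funext fg.
case: g / fg gK g'K gc => gK g'K gc.
have f'g' : f' = g' by apply/funext => x; rewrite -[x in LHS]g'K fK.
case: g' / f'g' gK g'K g'c => gK g'K g'c.
by congr Homeo; exact: Prop_irrelevance.
Qed.

Definition homeo_id : homeo X :=
  @Homeo X id id (fun=> erefl) (fun=> erefl) (fun=> cvg_id) (fun=> cvg_id).

Definition homeo_sym f : homeo X :=
  Homeo (@homeo_invK X f) (@homeo_funK X f)
        (@homeo_inv_continuous X f) (@homeo_fun_continuous X f).

Lemma homeo_comp_continuous (u v : X -> X) :
  continuous u -> continuous v -> continuous (u \o v).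
Proof. by move=> uc vc x; apply: continuous_comp; [exact: vc|exact: uc]. Qed.

Definition homeo_comp f g : homeo X :=
  @Homeo X (f \o g) (homeo_inv g \o homeo_inv f)
    (can_comp (@homeo_funK X f) (@homeo_funK X g))
    (can_comp (@homeo_invK X g) (@homeo_invK X f))
    (homeo_comp_continuous (@homeo_fun_continuous X f)
       (@homeo_fun_continuous X g))
    (homeo_comp_continuous (@homeo_inv_continuous X g)
       (@homeo_inv_continuous X f)).

Lemma homeo_compA : associative homeo_comp.
Proof. by move=> f g h; exact: homeoP. Qed.

Lemma homeo_comp1f : left_id homeo_id homeo_comp.
Proof. by move=> f; exact: homeoP. Qed.

Lemma homeo_compf1 : right_id homeo_id homeo_comp.
Proof. by move=> f; exact: homeoP. Qed.

Lemma homeo_compVf : left_inverse homeo_id homeo_sym homeo_comp.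
Proof. by move=> f; apply: homeoP => x /=; rewrite homeo_funK. Qed.

Lemma homeo_compfV : right_inverse homeo_id homeo_sym homeo_comp.
Proof. by move=> f; apply: homeoP => x /=; rewrite homeo_invK. Qed.

HB.instance Definition _ := gen_eqMixin (homeo X).
HB.instance Definition _ := gen_choiceMixin (homeo X).
HB.instance Definition _ := isGroup.Build (homeo X)
  homeo_compA homeo_comp1f homeo_compf1 homeo_compVf homeo_compfV.

Definition homeo_expz f (n : int) : homeo X :=
  match n with
  | Posz k => (f ^+ k)%g
  | Negz k => (f ^- k.+1)%g
  end.

Definition orbit (phi : homeo X) (x : X) : set X :=
  range (fun n : int => homeo_expz phi n x).

Definition full_group (phi : homeo X) : set (homeo X) :=
  [set f | forall x, orbit phi x (f x)].

(* The set of non-fixed points itself, not its closure. *)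
Definition supp f : set X := [set x | f x <> x].

(* The identity counts as an involution. *)
Definition involution f : Prop := (f ^+ 2 = 1)%g.

End HomeoGroup.

Definition Cantor_minimal_system (R : realType) (X : metricType R)
    (phi : homeo X) : Prop :=
  Cantor_set X /\ forall x : X, dense (orbit phi x).

(* Main.v *)
Require Import Defs.
From HB Require Import structures.
From mathcomp Require Import all_boot all_order all_algebra.
From mathcomp Require Import all_classical all_reals.
From mathcomp Require Import topology.
From mathcomp Require Import zify.

(** Locally, an element of the full group need not be a power of phi.  If all
    three involutions were locally powers of phi, the theorem would be false:
    on the homeomorphisms that are locally powers of phi, the net number of
    points moved across a cut of a phi-orbit is a homomorphism to the integers,
    with value 1 at phi and 0 at every involution.  So one needs elements of
    the full group with unbounded displacement near some point x0.

    Towers.  Take a clopen neighbourhood E of x0 whose return times are at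
    least 12, let f be the first return map of E and rho the homeomorphism that
    turns every column of the tower over E into a cycle, so phi = f rho.  Each
    cyclic rotation is a product of two reflections, so rho = r1 r2 with r1, r2
    involutions with clopen support ([tower_reflections]).  What remains is to
    absorb f.

    Swindle.  A set C in E, not containing x0, can be chosen such that all
    return times of f to C are odd ([odd_reduction]).  Rotation of an odd cycle
    is the square of a rotation that a reflection conjugates to its inverse
    ([odd_tower_sqrt]).  So f = a_0 q^2, where a_0 is the first return map of f
    on G_0 = C and q is conjugate to its inverse.  Now repeat: from a_k on G_k
    pass to the first return map b_k on a smaller set D_k with odd return
    times, a_k = b_k s_k^2, and carry D_k by elements of the full group onto a
    set G_(k+1) disjoint from everything used so far and close to x0.  This
    turns b_k into a_(k+1).  As the G_k shrink to x0, the infinite products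
    l = a_1 a_2 ... and s = s_0 s_1 ... are homeomorphisms
    ([infinite_prod_exists]), and so is a map c that conjugates every a_(k+1)
    to b_k.  Hence a_0 l = a_0 a_1 ... = (c l c^-1) s^2 ([swindle]), and
    therefore f = (c l c^-1) s s l^-1 q q.

    Spreading.  Conjugating phi = f rho by elements supported on the first six
    levels of the tower puts the six factors of f on six different levels
    ([spread_over_levels]).  On disjoint levels, a factor p together with a
    conjugate of its inverse is a product of two involutions, both of which
    exchange the two levels ([dihedral_mirror]).  The factors pair up in this
    way: c l c^-1 with l^-1, s with s, q with q, as s and q are conjugate to
    their inverses.  So phi is conjugate to a b r1 r2 where a, b are involutions whose support is the union S of the
    six levels.  Since the columns have height at least 12, r1 moves S off
    itself, and with b' = r1 b r1 we get a b r1 r2 = (a b') (b b' r1) r2, a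
    product of three involutions with clopen support
    ([dihedral_times_reflections]). *)

Set Implicit Arguments.
Unset Strict Implicit.
Unset Printing Implicit Defensive.

Local Open Scope classical_set_scope.
Local Open Scope group_scope.
Local Notation orbit := Defs.orbit.

(** * Orbits and full groups *)

Section Homeo.
Variable X : topologicalType.
Implicit Types (f g h phi : homeo X) (x y z : X) (A C : set X).

Lemma homeoM f g x : (f * g) x = f (g x). Proof. by []. Qed.

Lemma homeo1 x : (1 : homeo X) x = x. Proof. by []. Qed.

Lemma homeoK f : cancel f (f^-1)%g. Proof. exact: homeo_funK. Qed.

Lemma homeoVK f : cancel (f^-1)%g f. Proof. exact: homeo_invK. Qed.

Lemma homeo_inj f : injective f. Proof. exact: can_inj (homeoK f). Qed.

Lemma homeoXS f n x : (f ^+ n.+1) x = f ((f ^+ n) x).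
Proof. by rewrite expgS. Qed.

Lemma homeoXSr f n x : (f ^+ n.+1) x = (f ^+ n) (f x).
Proof. by rewrite expgSr. Qed.

Lemma homeoXD f m n x : (f ^+ (m + n)) x = (f ^+ m) ((f ^+ n) x).
Proof. by rewrite expgnDr. Qed.

Lemma orbitP phi x y :
  orbit phi x y <-> exists m n, (phi ^+ m)%g x = (phi ^+ n)%g y.
Proof.
split.
  case=> -[n|n] _ <- /=; first by exists n, 0%N.
  by exists 0%N, n.+1; exact/esym/homeo_invK.
case=> m [n mn]; case: (leqP n m) => [/subnKC|/ltnW/subnKC] e.
  apply: (@ex_intro2 int _ _ (Posz (m - n))) => //=.
  apply: (@homeo_inj (phi ^+ n)).
  by rewrite -mn -homeoXD e.
case: (n - m)%N e mn => [|k] <- mn.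
  apply: (@ex_intro2 int _ _ (Posz 0)) => //=; apply: (@homeo_inj (phi ^+ m)).
  by rewrite mn addn0.
apply: (@ex_intro2 int _ _ (Negz k)) => //=; apply: (@homeo_inj (phi ^+ k.+1)).
rewrite homeo_invK; apply: (@homeo_inj (phi ^+ m)).
by rewrite mn homeoXD.
Qed.

Lemma orbit_refl phi x : orbit phi x x.
Proof. by apply/orbitP; exists 0%N, 0%N. Qed.

Lemma orbit_sym phi x y : orbit phi x y -> orbit phi y x.
Proof. by move=> /orbitP[m [n e]]; apply/orbitP; exists n, m. Qed.

Lemma orbit_trans phi y x z : orbit phi x y -> orbit phi y z -> orbit phi x z.
Proof.
move=> /orbitP[m [n e]] /orbitP[p [q e']]; apply/orbitP.
exists (p + m)%N, (n + q)%N; rewrite homeoXD e -homeoXD addnC homeoXD e'.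
by rewrite -homeoXD.
Qed.

Lemma full_group1 phi : full_group phi 1.
Proof. by move=> x; exact: orbit_refl. Qed.

Lemma full_groupM phi f g :
  full_group phi f -> full_group phi g -> full_group phi (f * g).
Proof. by move=> ff fg x; exact: (orbit_trans (fg x) (ff _)). Qed.

Lemma full_groupV phi f : full_group phi f -> full_group phi f^-1.
Proof.
by move=> ff x; apply: orbit_sym; have := ff (f^-1 x); rewrite homeoVK.
Qed.

Lemma full_groupX phi f n : full_group phi f -> full_group phi (f ^+ n).
Proof.
move=> ff; elim: n => [|n IH]; first exact: full_group1.
by rewrite expgS; exact: full_groupM.
Qed.

Lemma full_group_self phi : full_group phi phi.
Proof. by move=> x; apply/orbitP; exists 1%N, 0%N. Qed.

Lemma continuous_near_eq (f g : X -> X) x :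
  (\forall y \near x, f y = g y) -> {for x, continuous g} ->
  {for x, continuous f}.
Proof.
move=> fg cg; have e : f x = g x by exact: (nbhs_singleton fg).
rewrite /prop_for /continuous_at e; apply: cvg_trans cg; apply: near_eq_cvg.
by near=> y; apply/esym; near: y.
Unshelve. all: by end_near. Qed.

Lemma homeo_nbhs f x A : nbhs (f x) A -> nbhs x (f @^-1` A).
Proof. by move=> /(@homeo_fun_continuous _ f x). Qed.

(** Where f agrees with h, its inverse agrees with h^-1; this gives the
    continuity of both. *)
Lemma homeo_glue phi (f g : X -> X) : cancel f g -> cancel g f ->
  (forall x, exists2 h, full_group phi h & \forall y \near x, f y = h y) ->
  exists2 F : homeo X, full_group phi F & F =1 f.
Proof.
move=> fK gK loc.
have cf : continuous f.
  move=> x; have [h _ fh] := loc x.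
  exact: (continuous_near_eq fh (@homeo_fun_continuous _ h x)).
have cg : continuous g.
  move=> y; have [h _ fh] := loc (g y).
  apply: (@continuous_near_eq _ (h^-1)%g y);
    last exact: (@homeo_fun_continuous _ (h^-1)%g).
  have hy : h^-1 y = g y.
    by rewrite -[in LHS](gK y) (nbhs_singleton fh) homeoK.
  rewrite -hy in fh; have := homeo_nbhs fh.
  by apply: filterS => z e; rewrite -(fK ((h^-1)%g z)); rewrite e homeoVK.
exists (Homeo fK gK cf cg) => // x /=.
by have [h fh /nbhs_singleton ->] := loc x; exact: fh.
Qed.

Lemma clopen_near C x : clopen C -> \forall y \near x, C y <-> C x.
Proof.
move=> [oC cC]; case: (pselect (C x)) => Cx.
  by near=> y; split=> // _; near: y; exact: open_nbhs_nbhs.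
near=> y; split=> // Cy; suff: (~` C) y by [].
by near: y; apply: open_nbhs_nbhs; split=> //; exact: closed_openC.
Unshelve. all: by end_near. Qed.

Lemma clopen_from_near A :
  (forall x, \forall y \near x, A y <-> A x) -> clopen A.
Proof.
move=> Anear; split.
  by rewrite openE => x Ax; apply: filterS (Anear x) => y Ay; exact/Ay.
rewrite -openC openE => x Ax; apply: filterS (Anear x) => y Ay Ay'.
by apply: Ax; apply/Ay.
Qed.

Lemma open_preimage f A : open A -> open (f @^-1` A).
Proof.
by move=> oA; apply: open_comp => // y _; exact: homeo_fun_continuous.
Qed.

Lemma clopen_preimage f C : clopen C -> clopen (f @^-1` C).
Proof.
by move=> [oC cC]; split; [apply: open_comp|apply: closed_comp] => // y _;
  exact: homeo_fun_continuous.
Qed.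

End Homeo.

(** * Exchanging clopen sets, and infinite products *)

Section Gluing.
Variables (X : topologicalType) (phi : homeo X).
Implicit Types (f g h : homeo X) (x y z : X) (A C : set X).

Definition supported A f := forall x, ~ A x -> f x = x.

Lemma supported_stable A f x : supported A f -> A x -> A (f x).
Proof.
move=> sf Ax; apply: contrapT => nAf; apply: (nAf).
by rewrite (homeo_inj (sf _ nAf)).
Qed.

Lemma supportedS A C f : A `<=` C -> supported A f -> supported C f.
Proof. by move=> AC sf x nC; apply: sf => /AC. Qed.

Lemma supportedM A f g : supported A f -> supported A g -> supported A (f * g).
Proof. by move=> sf sg x nA; rewrite homeoM sg// sf. Qed.

Lemma supportedV A f : supported A f -> supported A f^-1.
Proof. by move=> sf x nA; apply: (@homeo_inj _ f); rewrite homeoVK sf. Qed.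

Lemma supported_commute A C f g : supported A f -> supported C g ->
  (forall x, A x -> ~ C x) -> f * g = g * f.
Proof.
move=> sf sg AC; apply: homeoP => x; rewrite !homeoM.
case: (pselect (A x)) => Ax.
  rewrite (sg x); last exact: AC.
  by rewrite sg//; apply: AC; exact: supported_stable.
rewrite (sf x)//; case: (pselect (C x)) => Cx; last by rewrite sg// sf.
by rewrite sf// => /AC; apply; exact: supported_stable.
Qed.

Lemma swap_exists C h : clopen C -> full_group phi h ->
  (forall x, C x -> ~ C (h x)) ->
  exists t : homeo X, [/\ full_group phi t, t * t = 1,
    forall x, C x -> t x = h x, forall x, C x -> t (h x) = x
    & forall x, ~ C x -> ~ C ((h^-1)%g x) -> t x = x].
Proof.
move=> clC fh Ch.
pose F x := if pselect (C x) then h x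
  else if pselect (C ((h^-1)%g x)) then (h^-1)%g x else x.
have F1 x : C x -> F x = h x by rewrite /F; case: pselect.
have F2 x : C ((h^-1)%g x) -> F x = (h^-1)%g x.
  move=> C'x; rewrite /F; case: (pselect (C x)) => Cx; last by case: pselect.
  by have := Ch _ C'x; rewrite homeoVK.
have F3 x : ~ C x -> ~ C ((h^-1)%g x) -> F x = x.
  by move=> nC nC'; rewrite /F; do 2 case: pselect => //.
have FK : involutive F.
  move=> x; case: (pselect (C x)) => Cx.
    by rewrite (F1 _ Cx) F2 homeoK.
  case: (pselect (C ((h^-1)%g x))) => C'x; last by rewrite !F3.
  by rewrite (F2 _ C'x) F1// homeoVK.
have [x|t ft tE] := homeo_glue (phi := phi) FK FK.
  have nC := clopen_near x clC.
  have nC' := clopen_near x (clopen_preimage (h^-1)%g clC).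
  case: (pselect (C x)) => Cx.
    by exists h => //; apply: filterS nC => y Cy; rewrite F1//; apply/Cy.
  case: (pselect (C ((h^-1)%g x))) => C'x.
    exists (h^-1)%g; first exact: full_groupV.
    by apply: filterS nC' => y Cy; rewrite F2//; apply/Cy.
  exists 1; first exact: full_group1.
  by apply: filterS2 nC nC' => y Cy C'y; rewrite F3// => [/Cy|/C'y].
exists t; split => //.
- by apply: homeoP => x; rewrite homeoM !tE FK.
- by move=> x Cx; rewrite tE F1.
- by move=> x Cx; rewrite tE F2 homeoK.
- by move=> x C1 C2; rewrite tE F3.
Qed.

(** Away from x0 only finitely many of the sets C k come near a given point,
    so the product is locally one of its factors or the identity.  At x0 it is
    continuous because every factor maps C k to itself and the C k shrink to
    x0.  This is the source of all homeomorphisms in the proof that are not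
    locally powers of phi. *)
Lemma infinite_prod_exists (x0 : X) (C : nat -> set X) (g : nat -> homeo X) :
  hausdorff_space X ->
  (forall k, clopen (C k)) -> (forall k, ~ C k x0) ->
  (forall j k x, C j x -> C k x -> j = k) ->
  (forall U, nbhs x0 U -> exists K, forall k, (K <= k)%N -> C k `<=` U) ->
  (forall k, full_group phi (g k)) -> (forall k, supported (C k) (g k)) ->
  exists F : homeo X, [/\ full_group phi F,
    forall k x, C k x -> F x = g k x
    & forall x, (forall k, ~ C k x) -> F x = x].
Proof.
move=> hX clC Cx0 Cdisj Ccvg.
pose F (g : nat -> homeo X) x :=
  if pselect (exists k, C k x) is left e then g (sval (cid e)) x else x.
have FE (g' : nat -> homeo X) k x : C k x -> F g' x = g' k x.
  move=> Cx; rewrite /F; case: pselect => [e|n]; last by case: n; exists k.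
  by case: cid => j /= Cj; rewrite (Cdisj _ _ _ Cj Cx).
have FE0 (g' : nat -> homeo X) x : (forall k, ~ C k x) -> F g' x = x.
  by move=> nC; rewrite /F; case: pselect => // e; by have [k /nC] := e.
have near0 (K : nat) x :
    \forall y \near x, forall k, (k < K)%N -> C k y <-> C k x.
  elim: K => [|K IH]; first by near=> y.
  have := clopen_near x (clC K); apply: filterS2 IH => y IH CK k.
  by rewrite ltnS leq_eqVlt => /orP[/eqP->|/IH].
have cF (g' : nat -> homeo X) :
    (forall k, supported (C k) (g' k)) -> continuous (F g').
  move=> sg x; case: (pselect (x = x0)) => [->|xx0].
    move=> U; rewrite FE0// => Ux0.
    have [K KU] := Ccvg _ Ux0.
    have : \forall y \near x0, U y /\ forall k, (k < K)%N -> C k y <-> C k x0.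
      by apply: filterS2 Ux0 (near0 K x0) => y; split.
    apply: filterS => y [Uy Ky]; rewrite /preimage /mkset.
    case: (pselect (exists k, C k y)) => [[k Ck]|nC]; last first.
      by rewrite FE0// => k Ck; apply: nC; exists k.
    rewrite (FE _ k)//; apply: (KU k); last exact: supported_stable.
    by rewrite leqNgt; apply/negP => kK; have := (Ky _ kK).1 Ck; exact: Cx0.
  have := hX; rewrite open_hausdorff => /(_ _ _ (introN eqP xx0)).
  move=> [[U V] /= [/set_mem Ux /set_mem Vx0 [oU oV UV]]].
  have [K KV] : exists K, forall k, (K <= k)%N -> C k `<=` V.
    by apply: Ccvg; exact: open_nbhs_nbhs.
  have nU : nbhs x U by exact: open_nbhs_nbhs.
  have big k y : U y -> C k y -> (k < K)%N.
    move=> Uy Ck; rewrite ltnNge; apply/negP => /KV /(_ _ Ck) Vy.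
    by have : (U `&` V) y by []; move/eqP: UV => ->.
  case: (pselect (exists k, C k x)) => [[k Ck]|nC].
    apply: (@continuous_near_eq _ _ (g' k) x); last exact: homeo_fun_continuous.
    by apply: filterS (clopen_near x (clC k)) => y Cy; apply: FE; apply/Cy.
  apply: (@continuous_near_eq _ _ (1 : homeo X) x);
    last exact: homeo_fun_continuous.
  apply: filterS2 nU (near0 K x) => y Uy Ky; apply: FE0 => k Ck.
  by apply: nC; exists k; apply/(Ky _ (big _ _ Uy Ck)).
move=> fg sg; pose g' (k : nat) := (g k)^-1.
have sg' k : supported (C k) (g' k) by exact/supportedV/sg.
have FK (u v : nat -> homeo X) : (forall k, supported (C k) (u k)) ->
    (forall k, cancel (u k) (v k)) -> cancel (F u) (F v).
  move=> su uv x; rewrite /=; case: (pselect (exists k, C k x)) => [[k Ck]|nC].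
    have Cux : C k (u k x) by exact: (supported_stable (su k)).
    by rewrite (FE _ k x)// (FE _ k)// uv.
  by rewrite !FE0// => k Ck; apply: nC; exists k.
have K1 := FK g g' sg (fun k => homeoK (g k)).
have K2 := FK g' g sg' (fun k => homeoVK (g k)).
exists (Homeo K1 K2 (cF _ sg) (cF _ sg')); split=> [x||]; last 2 first.
- exact: FE.
- exact: FE0.
case: (pselect (exists k, C k x)) => [[k Ck]|nC] /=.
  by rewrite (FE _ k)//; exact: fg.
by rewrite FE0; [exact: orbit_refl|move=> k Ck; apply: nC; exists k].
Unshelve. all: by end_near. Qed.

End Gluing.

(** * Towers over a clopen set *)

Section Columns.
Variable X : topologicalType.
Implicit Types (a b f g h : homeo X) (x y z d : X) (A C D G : set X).

Definition return_time a D d (n : nat) :=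
  [/\ (0 < n)%N, D ((a ^+ n)%g d)
    & forall i, (0 < i < n)%N -> ~ D ((a ^+ i)%g d)].

(** The column with foot d has height n, and x is its point at height j. *)
Definition column a D x d (n j : nat) :=
  [/\ D d, return_time a D d n, (j < n)%N & x = (a ^+ j)%g d].

(** The bound N, uniform in x, makes this one-sided recurrence two-sided: a
    visit within N steps from a^-N x does not come after x. *)
Definition syndetic a G := forall C, open C -> C !=set0 -> C `<=` G ->
  exists N, forall x, G x ->
    exists n, [/\ (0 < n)%N, (n <= N)%N & C ((a ^+ n)%g x)].

Lemma return_time_exists a D d n :
  (0 < n)%N -> D ((a ^+ n)%g d) -> exists m, return_time a D d m.
Proof.
move=> n0 Dn; pose P k := `[< (0 < k)%N /\ D ((a ^+ k)%g d) >].
have exP : exists k, P k by exists n; apply/asboolP.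
case: (ex_minnP exP) => m /asboolP[m0 Dm] mmin.
exists m; split=> // i /andP[i0 im] Di.
suff /mmin : P i by rewrite leqNgt im.
by apply/asboolP.
Qed.

Lemma return_time_uniq a D d m n :
  return_time a D d m -> return_time a D d n -> m = n.
Proof.
move=> [m0 Dm mP] [n0 Dn nP]; case: (ltngtP m n) => // mn.
  by case: (nP m); rewrite ?m0.
by case: (mP n); rewrite ?n0.
Qed.

Lemma column_uniq a D x d d' n n' j j' :
  column a D x d n j -> column a D x d' n' j' ->
  [/\ d = d', n = n' & j = j'].
Proof.
wlog jj' : d d' n n' j j' / (j <= j')%N.
  move=> H c c'; case: (leqP j j') => [|/ltnW] jj'; first exact: H jj' c c'.
  by have [-> -> ->] := H _ _ _ _ _ _ jj' c' c.
move=> [Dd rd jn xE] [Dd' rd' jn' xE'].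
have dE : d = (a ^+ (j' - j))%g d'.
  apply: (@homeo_inj _ (a ^+ j)).
  by rewrite -xE xE' -homeoXD subnKC.
have jE : j = j'.
  apply/eqP; rewrite eqn_leq jj' leqNgt; apply/negP => jltj'.
  case: rd' => _ _ /(_ (j' - j)%N); rewrite -dE; apply => //.
  by rewrite subn_gt0 jltj' (leq_ltn_trans (leq_subr _ _)).
move: dE; rewrite jE subnn => dE; split=> //.
by move: rd rd'; rewrite dE; exact: return_time_uniq.
Qed.

Lemma return_time_near a D d n : clopen D -> return_time a D d n ->
  \forall y \near d, return_time a D y n.
Proof.
move=> cD [n0 Dn nP].
have : \forall y \near d,
    forall i, (i <= n)%N -> D ((a ^+ i)%g y) <-> D ((a ^+ i)%g d).
  elim: n {n0 Dn nP} => [|n IH].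
    apply: filterS (clopen_near d cD) => y yd i.
    by rewrite leqn0 => /eqP->.
  have := clopen_near d (clopen_preimage (a ^+ n.+1) cD).
  apply: filterS2 IH => y IH yn i.
  by rewrite leq_eqVlt => /orP[/eqP->|/IH].
apply: filterS => y Hy; split=> //; first by apply/Hy.
by move=> i i0n /Hy Di; apply: (nP i) => //; apply: Di; lia.
Qed.

Lemma supportedX a A n : supported A a -> supported A (a ^+ n).
Proof.
move=> sa; elim: n => [|n IH]; first by [].
by rewrite expgS; exact: supportedM.
Qed.

Lemma supported_stableX a A n x : supported A a -> A x -> A ((a ^+ n)%g x).
Proof. by move=> /(@supportedX _ _ n); exact: supported_stable. Qed.

Section Fixed.
Variables (phi a : homeo X) (G D : set X).
Hypotheses (fa : full_group phi a) (clG : clopen G) (sa : supported G a).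
Hypotheses (aG : syndetic a G) (clD : clopen D) (DG : D `<=` G).
Hypothesis D0 : D !=set0.

Lemma return_time_total d : G d -> exists n, return_time a D d n.
Proof.
move=> Gd; have [N /(_ _ Gd)[n [n0 _ Dn]]] := aG clD.1 D0 DG.
exact: return_time_exists Dn.
Qed.

Lemma column_total x : G x -> exists d n j, column a D x d n j.
Proof.
move=> Gx; have [N NP] := aG clD.1 D0 DG.
pose P j := `[< exists d, D d /\ x = (a ^+ j)%g d >].
have exP : exists j, P j.
  have Gy : G (((a ^+ N)^-1)%g x).
    exact: (supported_stable (supportedV (supportedX N sa))).
  have [n [n0 nN Dn]] := NP _ Gy; exists (N - n)%N; apply/asboolP.
  by eexists; split; first exact: Dn; rewrite -homeoXD subnK// homeoVK.
case: (ex_minnP exP) => j /asboolP[d [Dd xE]] jmin.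
have [n rn] := return_time_total (DG Dd); exists d, n, j; split=> //.
rewrite ltnNge; apply/negP => nj; case: (rn) => n0 Dn _.
suff /jmin : P (j - n)%N by rewrite leqNgt; case/negP; lia.
by apply/asboolP; eexists; split; first exact: Dn; rewrite -homeoXD subnK.
Qed.

Lemma column_in x d n j : column a D x d n j -> G x.
Proof. by move=> [Dd _ _ ->]; apply: supported_stableX => //; exact: DG. Qed.

Lemma column_near x d n j : column a D x d n j ->
  \forall y \near x, column a D y (((a ^+ j)^-1)%g y) n j.
Proof.
move=> [Dd rd jn xE].
have dE : d = ((a ^+ j)^-1)%g x by rewrite xE homeoK.
rewrite dE in Dd rd.
have := homeo_nbhs (return_time_near clD rd).
have := clopen_near x (clopen_preimage ((a ^+ j)^-1)%g clD).
by apply: filterS2 => y Dy ry; split=> //; [exact/Dy|rewrite homeoVK].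
Qed.

(** The height of a point in its column, and the height of that column, are
    locally constant, so permuting the heights in all columns is locally a
    power of a. *)
Lemma column_map (p p' : nat -> nat -> nat) :
  (forall n j, (j < n)%N -> [/\ (p n j < n)%N, (p' n j < n)%N,
     p' n (p n j) = j & p n (p' n j) = j]) ->
  exists T : homeo X, [/\ full_group phi T, supported G T &
    forall x d n j, column a D x d n j -> T x = (a ^+ (p n j))%g d].
Proof.
move=> pP.
pose F (q : nat -> nat -> nat) x :=
  if pselect (exists u : X * nat * nat, column a D x u.1.1 u.1.2 u.2)
  is left e then let u := sval (cid e) in (a ^+ (q u.1.2 u.2))%g u.1.1 else x.
have FE q x d n j : column a D x d n j -> F q x = (a ^+ (q n j))%g d.
  move=> c; rewrite /F; case: pselect => [e|nc]; last first.
    by case: nc; exists (d, n, j).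
  by case: cid => -[[d' n'] j'] /= c'; have [-> -> ->] := column_uniq c c'.
have FE0 q x : ~ G x -> F q x = x.
  move=> nG; rewrite /F; case: pselect => // e.
  by have [u /column_in] := e.
have FK q q' : (forall n j, (j < n)%N -> (q n j < n)%N) ->
    (forall n j, (j < n)%N -> q' n (q n j) = j) -> cancel (F q) (F q').
  move=> qP qK x; case: (pselect (G x)) => Gx; last by rewrite !FE0// FE0.
  have [d [n [j c]]] := column_total Gx; rewrite (FE _ _ _ _ _ c).
  case: c => Dd rd jn ->; rewrite (FE _ _ d n (q n j)); first by rewrite qK.
  by split=> //; exact: qP.
have [||x|T fT TE] := @homeo_glue _ phi (F p) (F p').
- by apply: FK => n j /pP[].
- by apply: FK => n j /pP[].
- case: (pselect (G x)) => Gx; last first.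
    exists 1; first exact: full_group1.
    by apply: filterS (clopen_near x clG) => y Gy; rewrite FE0// => /Gy.
  have [d [n [j c]]] := column_total Gx.
  exists (a ^+ p n j * (a ^+ j)^-1)%g.
    by apply: full_groupM; [|apply: full_groupV]; exact: full_groupX.
  by apply: filterS (column_near c) => y cy; rewrite (FE _ _ _ _ _ cy).
exists T; split=> //.
- by move=> x Gx; rewrite TE FE0.
- by move=> x d n j c; rewrite TE (FE _ _ _ _ _ c).
Qed.

Lemma column_clopen_supp (p : nat -> nat -> nat) (T : homeo X) :
  supported G T -> (forall n j, (j < n)%N -> (p n j < n)%N) ->
  (forall x d n j, column a D x d n j -> T x = (a ^+ (p n j))%g d) ->
  clopen (supp T).
Proof.
move=> sT pP TE.
apply: clopen_from_near => x.
case: (pselect (G x)) => Gx; last first.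
  apply: filterS (clopen_near x clG) => y Gy.
  by rewrite /supp /mkset !sT// => /Gy.
have [d [n [j c]]] := column_total Gx.
have suppE y e : column a D y e n j -> supp T y <-> p n j <> j.
  move=> cy; rewrite /supp /mkset (TE _ _ _ _ cy); case: (cy) => De re jn yE.
  split; first by move=> ne pj; apply: ne; rewrite pj.
  move=> ne eq; apply: ne.
  have c' : column a D y e n (p n j) by split=> //; exact: pP.
  by have [] := column_uniq cy c'.
apply: filterS (column_near c) => y cy.
by rewrite (suppE _ _ cy) (suppE _ _ c).
Qed.

Lemma homeo_ext_column (T T' : homeo X) : supported G T -> supported G T' ->
  (forall x d n j, column a D x d n j -> T x = T' x) -> T = T'.
Proof.
move=> sT sT' TT'; apply: homeoP => x.
case: (pselect (G x)) => Gx; last by rewrite sT// sT'.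
by have [d [n [j c]]] := column_total Gx; exact: TT' c.
Qed.

Variable rho : homeo X.
Hypothesis (srho : supported G rho).
Hypothesis rhoE : forall x d n j, column a D x d n j ->
  rho x = (a ^+ (if j.+1 == n then 0%N else j.+1))%g d.
Let b := (a * rho^-1)%g.

(** With rho the cyclic rotation of the columns, b = a rho^-1 steps down and up
    again except at the foot of a column; it sends the foot to the top and from
    there to the next visit to D. *)
Lemma first_return_supported : supported D b.
Proof.
move=> x nD; rewrite /b homeoM; case: (pselect (G x)) => Gx; last first.
  by rewrite (supportedV srho)// sa.
have [d [n [[|j] [Dd rd jn xE]]]] := column_total Gx.
  by case: nD; rewrite xE.
have c : column a D ((a ^+ j)%g d) d n j by split=> //; exact: ltnW.
have : rho ((a ^+ j)%g d) = x by rewrite (rhoE c) xE ltn_eqF.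
by move=> <-; rewrite homeoK (rhoE c) ltn_eqF// homeoXS.
Qed.

Lemma first_returnE d n : D d -> return_time a D d n -> b d = (a ^+ n)%g d.
Proof.
move=> Dd; case: n => [[]//|n] rd; rewrite /b homeoM.
have c : column a D ((a ^+ n)%g d) d n.+1 n by split.
have : rho ((a ^+ n)%g d) = d by rewrite (rhoE c) eqxx.
by move=> {1}<-; rewrite homeoK homeoXS.
Qed.

(** The b-orbit of a point of D runs through all visits of its a-orbit to D, in
    the same order. *)
Lemma first_return_syndetic : syndetic b D.
Proof.
move=> C oC C0 CD.
have [N NP] := aG oC C0 (subset_trans CD DG); exists N => x Dx.
have [n [n0 nN Cn]] := NP _ (DG Dx).
suff [i [i0 ileqn bi]] : exists i, [/\ (0 < i)%N, (i <= n)%N &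
    (b ^+ i)%g x = (a ^+ n)%g x].
  by exists i; split=> //; [exact: leq_trans nN|rewrite bi].
elim/ltn_ind: n x Dx {NP nN} n0 Cn => n IH x Dx n0 Cn.
have [m rm] := return_time_total (DG Dx).
have mn : (m <= n)%N.
  rewrite leqNgt; apply/negP => nm; case: rm => _ _ /(_ n).
  by rewrite n0 nm => /(_ isT); apply; exact: CD.
have bx := first_returnE Dx rm; case: (rm) => m0 Dm _.
have nE : (a ^+ n)%g x = (a ^+ (n - m))%g (b x).
  by rewrite bx -homeoXD subnK.
move: (mn); rewrite leq_eqVlt => /orP[/eqP mE|mltn].
  by exists 1%N; rewrite expg1 bx mE.
have [||||i [i0 ile bi]] := IH (n - m)%N _ (b x).
- lia.
- by rewrite bx.
- lia.
- by rewrite -nE.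
exists i.+1; split=> //; first lia.
by rewrite homeoXSr bi nE.
Qed.

End Fixed.
End Columns.

(** * Reflections and square roots of tower rotations *)

Section ColumnMaps.
Variable X : topologicalType.
Variables (phi a : homeo X) (G D : set X).
Hypotheses (fa : full_group phi a) (clG : clopen G) (sa : supported G a).
Hypotheses (aG : syndetic a G) (clD : clopen D) (DG : D `<=` G).
Hypothesis D0 : D !=set0.

Lemma column_shift x d n j i :
  column a D x d n j -> (i < n)%N -> column a D ((a ^+ i)%g d) d n i.
Proof. by move=> [Dd rd _ _] ilt; split. Qed.

Lemma first_return_decomposition (rho : homeo X) : full_group phi rho ->
  supported G rho ->
  (forall x d n j, column a D x d n j ->
    rho x = (a ^+ (if j.+1 == n then 0%N else j.+1))%g d) ->
  [/\ a = a * rho^-1 * rho, full_group phi (a * rho^-1),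
      supported D (a * rho^-1) & syndetic (a * rho^-1) D].
Proof.
move=> frho srho rhoE; split.
- by rewrite -mulgA mulVg mulg1.
- by apply: full_groupM => //; exact: full_groupV.
- exact: (first_return_supported sa aG clD DG D0 srho rhoE).
- exact: (first_return_syndetic aG clD DG D0 rhoE).
Qed.

(** The rotation j |-> j + 1 of a cycle of length n is the composite of the
    reflections j |-> n - 2 - j and j |-> n - 1 - j modulo n. *)
Lemma tower_reflections : exists r1 r2 b : homeo X,
  [/\ [/\ full_group phi r1, full_group phi r2 & full_group phi b],
      [/\ r1 * r1 = 1, r2 * r2 = 1 & a = b * (r1 * r2)],
      [/\ clopen (supp r1), clopen (supp r2), supported D b & syndetic b D],
      forall x d n j, column a D x d n j -> r1 x = (a ^+ (n.-1 - j))%g d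
    & forall x d n j, column a D x d n j -> (j.+1 < n)%N ->
        (r1 * r2) x = (a ^+ j.+1)%g d].
Proof.
pose p1 n j := (n.-1 - j)%N.
pose p2 n j := if j.+1 == n then j else (n.-2 - j)%N.
have p1P n j : (j < n)%N -> (p1 n j < n)%N by rewrite /p1; lia.
have p1K n j : (j < n)%N -> p1 n (p1 n j) = j by rewrite /p1; lia.
have p2P n j : (j < n)%N -> (p2 n j < n)%N by rewrite /p2; case: ifP; lia.
have p2K n j : (j < n)%N -> p2 n (p2 n j) = j.
  by rewrite /p2; do 2! [case: ifP => /eqP]; lia.
have [r1 [fr1 sr1 r1E]] : exists T : homeo X, [/\ full_group phi T,
    supported G T & forall x d n j, column a D x d n j ->
      T x = (a ^+ (p1 n j))%g d].
  by apply: (column_map (p' := p1) fa clG sa aG clD DG D0) => n j jn;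
     split; rewrite ?p1P ?p1K.
have [r2 [fr2 sr2 r2E]] : exists T : homeo X, [/\ full_group phi T,
    supported G T & forall x d n j, column a D x d n j ->
      T x = (a ^+ (p2 n j))%g d].
  by apply: (column_map (p' := p2) fa clG sa aG clD DG D0) => n j jn;
     split; rewrite ?p2P ?p2K.
have ext := homeo_ext_column sa aG clD DG D0.
have r12E x d n j : column a D x d n j ->
    (r1 * r2) x = (a ^+ (if j.+1 == n then 0%N else j.+1))%g d.
  move=> c; have [_ _ jn _] := c.
  rewrite homeoM (r2E _ _ _ _ c) (r1E _ _ _ _ (column_shift c (p2P _ _ jn))).
  by congr ((a ^+ _)%g d); rewrite /p1 /p2; case: ifP => /eqP; lia.
have [aE fb sb bD] := first_return_decomposition (full_groupM fr1 fr2)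
  (supportedM sr1 sr2) r12E.
exists r1, r2, (a * (r1 * r2)^-1); split=> //; [split=> //|split=> //|].
- apply: ext => // [|x d n j c]; first exact: supportedM.
  have [_ _ jn xE] := c.
  rewrite homeoM (r1E _ _ _ _ c) (r1E _ _ _ _ (column_shift c (p1P _ _ jn))).
  by rewrite p1K.
- apply: ext => // [|x d n j c]; first exact: supportedM.
  have [_ _ jn xE] := c.
  rewrite homeoM (r2E _ _ _ _ c) (r2E _ _ _ _ (column_shift c (p2P _ _ jn))).
  by rewrite p2K.
- exact: (column_clopen_supp clG sa aG clD DG D0 sr1 p1P r1E).
- exact: (column_clopen_supp clG sa aG clD DG D0 sr2 p2P r2E).
- by move=> x d n j c jn; rewrite (r12E _ _ _ _ c) ltn_eqF.
Qed.

(** In a cycle of odd length n, rotation by (n + 1) / 2 is a square root of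
    rotation by 1, and every reflection conjugates it to its inverse; this is
    what the last equation says of s and the reflection m. *)
Lemma odd_tower_sqrt :
  (forall d n, D d -> return_time a D d n -> odd n) ->
  exists s m b : homeo X,
  [/\ [/\ full_group phi s, full_group phi m & full_group phi b],
      [/\ supported G s, supported G m, supported D b & syndetic b D],
      a = b * (s * s) & s * m * s = m].
Proof.
move=> oddD.
pose p n j := if (j < n./2)%N then (j + n./2 + 1)%N else (j - n./2)%N.
pose p' n j := if (j <= n./2)%N then (j + n./2)%N else (j - n./2 - 1)%N.
pose q n j := (n.-1 - j)%N.
(* Columns of even height do not occur, but a permutation has to be given. *)
pose onodd (f : nat -> nat -> nat) n j := if odd n then f n j else j.
have qP n j : (j < n)%N -> (q n j < n)%N by rewrite /q; lia.
have qK n j : (j < n)%N -> q n (q n j) = j by rewrite /q; lia.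
have pP n j : odd n -> (j < n)%N -> (p n j < n)%N.
  by rewrite /p; case: ifP; lia.
have p'P n j : odd n -> (j < n)%N -> (p' n j < n)%N.
  by rewrite /p'; case: ifP; lia.
have pK n j : odd n -> (j < n)%N -> p' n (p n j) = j.
  by rewrite /p /p'; do 2! [case: ifP]; lia.
have p'K n j : odd n -> (j < n)%N -> p n (p' n j) = j.
  by rewrite /p /p'; do 2! [case: ifP]; lia.
have [m [fm sm mE]] : exists T : homeo X, [/\ full_group phi T,
    supported G T & forall x d n j, column a D x d n j ->
      T x = (a ^+ (q n j))%g d].
  by apply: (column_map (p' := q) fa clG sa aG clD DG D0) => n j jn;
     split; rewrite ?qP ?qK.
have [s [fs ss sE']] : exists T : homeo X, [/\ full_group phi T,
    supported G T & forall x d n j, column a D x d n j ->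
      T x = (a ^+ (onodd p n j))%g d].
  apply: (column_map (p' := onodd p') fa clG sa aG clD DG D0) => n j jn.
  by rewrite /onodd; case: ifP => on; split; rewrite ?pP ?p'P ?pK ?p'K.
have sE x d n j : column a D x d n j -> odd n /\ s x = (a ^+ (p n j))%g d.
  move=> c; have on : odd n by case: c => Dd rd _ _; exact: oddD rd.
  by split=> //; rewrite (sE' _ _ _ _ c) /onodd on.
have ext := homeo_ext_column sa aG clD DG D0.
have ssE x d n j : column a D x d n j ->
    (s * s) x = (a ^+ (if j.+1 == n then 0%N else j.+1))%g d.
  move=> c; have [on sx] := sE _ _ _ _ c; have [_ _ jn _] := c.
  have [_ ssx] := sE _ _ _ _ (column_shift c (pP _ _ on jn)).
  rewrite homeoM sx ssx; congr ((a ^+ _)%g d).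
  by rewrite /p; do 3! [case: ifP => // /eqP]; lia.
have [aE fb sb bD] := first_return_decomposition (full_groupM fs fs)
  (supportedM ss ss) ssE.
exists s, m, (a * (s * s)^-1); split=> //.
apply: ext => // [|x d n j c]; first by apply: supportedM; [exact: supportedM|].
have [on sx] := sE _ _ _ _ c; have [_ _ jn _] := c.
have cp := column_shift c (pP _ _ on jn).
have msx := mE _ _ _ _ cp.
have cq := column_shift c (qP _ _ (pP _ _ on jn)).
have [_ smsx] := sE _ _ _ _ cq.
rewrite !homeoM sx msx smsx (mE _ _ _ _ c); congr ((a ^+ _)%g d).
by rewrite /p /q; do 2! [case: ifP]; lia.
Qed.

End ColumnMaps.

(** * Towers of odd heights *)

Section OddTowers.
Variable X : topologicalType.
Implicit Types (a : homeo X) (B C D : set X).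

(** C consists of the points a x with x in B of even return time to B: adding
    a x splits an even return time n into 1 and n - 1. *)
Lemma odd_return_set a B : clopen B -> (forall x, B x -> ~ B (a x)) ->
  (forall x, B x -> exists n, return_time a B x n) ->
  exists C, [/\ clopen C, forall x, C x -> B ((a^-1)%g x) &
    forall d n, (B `|` C) d -> return_time a (B `|` C) d n -> odd n].
Proof.
move=> clB Ba retB.
pose E x := B x /\ exists2 n, ~~ odd n & return_time a B x n.
have clE : clopen E.
  apply: clopen_from_near => x; case: (pselect (B x)) => Bx; last first.
    by apply: filterS (clopen_near x clB) => y By;
      split=> -[Bz]//; have /By := Bz.
  have [n rx] := retB x Bx.
  apply: filterS2 (clopen_near x clB) (return_time_near clB rx) => y By ry.
  split=> -[B' [k ek rk]]; split=> //; try exact/By; exists n => //.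
    by rewrite (return_time_uniq ry rk).
  by rewrite (return_time_uniq rx rk).
pose C := (a^-1)%g @^-1` E.
have Ca x : C (a x) <-> E x by rewrite /C /preimage /mkset homeoK.
exists C; split=> [|x []//|d n BCd rd]; first exact: clopen_preimage.
suff [m om rm] : exists2 m, odd m & return_time a (B `|` C) d m.
  by rewrite (return_time_uniq rd rm).
case: BCd => [Bd|[Be [m em rm]]]; last first.
  have dE : d = a ((a^-1)%g d) by rewrite homeoVK.
  move: Be rm; rewrite {}dE homeoK; set e := (a^-1)%g d => Be rm.
  case: m rm em => [[]//|[|k]//= [_ Bk kP]]; rewrite negbK => ok.
  exists k.+1 => //=; split=> //; first by left; rewrite -homeoXSr.
  move=> i i0k; have Bi : ~ B ((a ^+ i.+1)%g e) by apply: kP; lia.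
  rewrite -homeoXSr => -[//|]; rewrite homeoXS => /Ca[Be' _].
  by case: (kP i) => //; lia.
have [m rm] := retB _ Bd; have [om|em] := boolP (odd m); last first.
  exists 1%N => //; split=> //; last by case.
  by right; apply/Ca; split=> //; exists m.
exists m => //; case: (rm) => m0 Bm mP; split=> //; first by left.
case=> [|i] i0m; first by lia.
case=> [|]; first exact: mP.
rewrite homeoXS => /Ca[Bi [k ek rk]].
case: i => [|i] in i0m Bi rk *; last by case: (mP i.+1) => //; lia.
by move: ek; rewrite (return_time_uniq rk rm) om.
Qed.

End OddTowers.

(** * Clopen sets in a Cantor minimal system *)

Section Topology.
Variables (R : realType) (X : metricType R) (phi : homeo X).
Hypothesis Hphi : Cantor_minimal_system phi.
Implicit Types (a : homeo X) (x y : X) (C G O U V : set X).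

Lemma clopen_nbhs x U : nbhs x U -> exists V, [/\ clopen V, V x & V `<=` U].
Proof.
case: Hphi => -[_ zX cX _] _ Ux.
have [V [Vx cV] VU] := zero_dimensional_cvg (@metric_hausdorff _ X) zX cX Ux.
by exists V.
Qed.

Lemma clopen_separate x y : x <> y -> exists U V,
  [/\ clopen U, clopen V, U x, V y & forall z, U z -> ~ V z].
Proof.
case: Hphi => -[_ zX _ _] _ /eqP /zX[U [cU Ux nUy]].
by exists U, (~` U); split=> //; [exact: clopenC|move=> z Uz nUz].
Qed.

Lemma no_isolated_point x U : nbhs x U -> exists2 y, U y & y <> x.
Proof.
case: Hphi => -[_ _ _ iX] _ Ux; apply: contrapT => noy.
suff : isolated [set: X] x by rewrite iX.
split; first exact/mem_set.
exists U => //; rewrite setIT; apply/seteqP; split=> [y Uy|y ->].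
  by apply: contrapT => yx; apply: noy; exists y.
exact: nbhs_singleton.
Qed.

Lemma split_open O : open O -> O !=set0 -> exists V1 V2,
  [/\ clopen V1 /\ clopen V2, V1 !=set0 /\ V2 !=set0,
      V1 `<=` O /\ V2 `<=` O & forall z, V1 z -> ~ V2 z].
Proof.
move=> oO [x Ox]; have Onx : nbhs x O by exact: open_nbhs_nbhs.
have [y Oy yx] := no_isolated_point Onx.
have Ony : nbhs y O by exact: open_nbhs_nbhs.
have [U [V [cU cV Uy Vx UV]]] := clopen_separate yx.
have [U' [cU' U'y U'O]] := clopen_nbhs Ony.
have [V' [cV' V'x V'O]] := clopen_nbhs Onx.
exists (U `&` U'), (V `&` V'); split.
- by split; exact: clopenI.
- by split; [exists y|exists x].
- by split=> z [_]; [exact: U'O|exact: V'O].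
- by move=> z [/UV nV _] [/nV].
Qed.

Lemma full_group_move x O : open O -> O !=set0 ->
  exists2 h, full_group phi h & O (h x).
Proof.
move=> oO O0; have [y [Oy oy]] := Hphi.2 x O O0 oO.
have /orbitP[m [n mn]] := oy.
exists ((phi ^+ n)^-1 * phi ^+ m)%g; last by rewrite homeoM mn homeoK.
by apply: full_groupM; [apply: full_groupV|];
  apply: full_groupX; exact: full_group_self.
Qed.

(** By compactness, finitely many translates phi^i C with i in Z cover X;
    shifting them all makes the exponents positive. *)
Lemma syndetic_self : syndetic phi [set: X].
Proof.
case: Hphi => -[_ _ cX _] dphi C oC C0 _.
pose P (N : nat) x :=
  exists m n, (m + n <= N)%N /\ C (((phi ^+ n)^-1 * phi ^+ m)%g x).
have : \forall N \near \oo, [set: X] `<=` P N.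
  move/compact_near_coveringP : cX; apply=> x _.
  have [y [Cy /orbitP[m [n mn]]]] := dphi x C C0 oC.
  exists (((phi ^+ n)^-1 * phi ^+ m)%g @^-1` C, [set N | m + n <= N]%N).
    split; last by exists (m + n)%N.
    apply: (@homeo_nbhs _ ((phi ^+ n)^-1 * phi ^+ m)%g).
    apply: open_nbhs_nbhs; split=> //.
    by rewrite homeoM mn homeoK.
  by move=> [z N] /= [Cz mnN]; exists m, n.
move=> [N _ /(_ N (leqnn N)) NP].
exists (N + N.+1)%N => x _.
have [m [n [mnN]]] := NP ((phi ^+ N.+1)%g x) I.
rewrite homeoM -homeoXD => Cx.
exists (m + N.+1 - n)%N; split; [lia|lia|].
move: Cx; rewrite -[(m + N.+1)%N in X in X -> _](@subnKC n); last by lia.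
by rewrite homeoXD homeoK.
Qed.

(** The orbit of a fixed point x could not visit the part of G that a clopen
    set separates from x. *)
Lemma syndetic_fixfree a G x : open G -> syndetic a G -> G x -> a x <> x.
Proof.
move=> oG aG Gx ax.
have Gnx : nbhs x G by exact: open_nbhs_nbhs.
have [y Gy yx] := no_isolated_point Gnx.
have [U [V [cU cV Uy Vx UV]]] := clopen_separate yx.
have [||z [Gz Uz]|N NP] := aG (G `&` U).
- by apply: openI => //; case: cU.
- by exists y.
- by [].
have [n [_ _ [_ Un]]] := NP x Gx; apply: (UV _ Un).
suff -> : (a ^+ n)%g x = x by [].
by elim: n {Un} => // n IH; rewrite homeoXS IH.
Qed.

End Topology.

(** * Reduction to a first return map, up to a square *)

Section Reduction.
Variables (R : realType) (X : metricType R) (phi : homeo X).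
Hypothesis Hphi : Cantor_minimal_system phi.
Implicit Types (a b g h s m t r : homeo X) (x y u : X) (B C D G V W E : set X).

Definition minimal_on G a :=
  [/\ full_group phi a, clopen G, supported G a & syndetic a G].

Definition square_reduction G a b s m :=
  [/\ full_group phi s /\ full_group phi m, supported G s /\ supported G m,
      a = b * (s * s) & s * m * s = m].

(** The two pieces of the new set lie near u and near a u, respectively; this
    is what allows to carry the set by two elements of the full group into a
    given open set. *)
Lemma odd_reduction G a u V V' : minimal_on G a -> G u ->
  nbhs u V -> nbhs (a u) V' ->
  exists B C b s m,
  [/\ [/\ clopen B, clopen C, B u, B `<=` V `&` G & C `<=` V' `&` G],
      forall x, B x -> ~ C x, minimal_on (B `|` C) b
    & square_reduction G a b s m].
Proof.
move=> [fa clG sa aG] Gu Vu V'u.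
have [U [U' [cU cU' Uu U'u UU']]] :=
  clopen_separate Hphi (not_eq_sym (syndetic_fixfree Hphi clG.1 aG Gu)).
have [B [clB Bu BS]] : exists B, [/\ clopen B, B u &
    B `<=` (V `&` G `&` U) `&` a @^-1` (V' `&` G `&` U')].
  apply: (clopen_nbhs Hphi); apply: filterI.
    apply: filterI; first apply: filterI => //.
      by apply: open_nbhs_nbhs; split=> //; case: clG.
    by apply: open_nbhs_nbhs; split=> //; case: cU.
  apply: homeo_nbhs; apply: filterI; first apply: filterI => //.
    apply: open_nbhs_nbhs; split; [by case: clG|exact: supported_stable].
  by apply: open_nbhs_nbhs; split=> //; case: cU'.
have BG : B `<=` G by move=> x /BS[[[]]].
have Ba x : B x -> ~ B (a x).
  by move=> /BS[_ [_ U'x]] /BS[[_ Ux] _]; exact: UU' U'x.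
have retB x : B x -> exists n, return_time a B x n.
  by move=> Bx; apply: (return_time_total aG clB BG) => //;
    [exists u|exact: BG].
have [C [clC CB oddD]] := odd_return_set clB Ba retB.
have CS x : C x -> [/\ V' x, G x & U' x].
  by move=> /CB/BS[_]; rewrite /preimage /mkset homeoVK => -[[]].
have DG : B `|` C `<=` G by move=> x [/BG//|/CS[]].
have D0 : (B `|` C) !=set0 by exists u; left.
have clD : clopen (B `|` C) by exact: clopenU.
have [s [m [b [[fs fm fb] [ss sm sb bD] aE smE]]]] :=
  odd_tower_sqrt fa clG sa aG clD DG D0 oddD.
exists B, C, b, s, m; split=> //; [split=> //|].
- by move=> x /BS[[[]]].
- by move=> x /CS[].
- by move=> x /BS[[_ Ux] _] /CS[_ _]; exact: UU' Ux.
Qed.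

Lemma minimal_on_conj D G b h : minimal_on D b -> full_group phi h ->
  (forall x, D x <-> G (h x)) -> minimal_on G (h * b * h^-1).
Proof.
move=> [fb clD sb bD] fh DG.
have GD x : G x <-> D ((h^-1)%g x) by rewrite DG homeoVK.
have GE : G = (h^-1)%g @^-1` D by apply/seteqP; split=> x /GD.
split.
- by apply: full_groupM; [exact: full_groupM|exact: full_groupV].
- by rewrite GE; exact: clopen_preimage.
- by move=> x /GD nD; rewrite !homeoM sb// homeoVK.
move=> C oC [c Cc] CG.
have [N NP] : exists N, forall x, D x ->
    exists n, [/\ (0 < n)%N, (n <= N)%N & C (h ((b ^+ n)%g x))].
  apply: (bD (h @^-1` C)) => [||x Cx]; last exact/DG/CG.
    exact: open_preimage.
  by exists ((h^-1)%g c); rewrite /preimage /mkset homeoVK.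
exists N => x /GD /NP[n [n0 nN Cn]]; exists n; split=> //.
suff -> : ((h * b * h^-1) ^+ n)%g x = h ((b ^+ n)%g ((h^-1)%g x)) by [].
elim: n {n0 nN Cn} => [|n IH]; first by rewrite !expg0 !homeo1 homeoVK.
by rewrite [LHS]homeoXS IH !homeoM homeoK homeoXS.
Qed.

Lemma double_swap B C h g :
  clopen B -> clopen C -> full_group phi h -> full_group phi g ->
  (forall x, B x -> ~ C x) -> (forall x, B x -> ~ B (h x)) ->
  (forall x, C x -> ~ C (g x)) -> (forall x, C x -> ~ B (g x)) ->
  (forall x, C x -> ~ B ((h^-1)%g (g x))) ->
  exists t, [/\ full_group phi t,
    supported ((B `|` C) `|` ((h^-1)%g @^-1` B `|` (g^-1)%g @^-1` C)) t,
    forall x, B x -> t x = h x & forall x, C x -> t x = g x].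
Proof.
move=> cB cC fh fg BC BhB CgC CgB ChgB.
have BgC x : B x -> ~ C ((g^-1)%g x) by move=> Bx /CgB; rewrite homeoVK.
have [t1 [ft1 _ t1B _ t1E]] := swap_exists cB fh BhB.
have [t2 [ft2 _ t2C _ t2E]] := swap_exists cC fg CgC.
exists (t1 * t2); split; first exact: full_groupM.
- move=> x nx; rewrite homeoM t2E ?t1E//; move=> ?; apply: nx.
  + by left; left.
  + by right; left.
  + by left; right.
  + by right; right.
- by move=> x Bx; rewrite homeoM t2E ?t1B//; [exact: BC|exact: BgC].
- by move=> x Cx; rewrite homeoM t2C// t1E//; [exact: CgB|exact: ChgB].
Qed.

End Reduction.

(** * One step of the swindle *)

Section Swindle.
Variables (R : realType) (X : metricType R) (phi : homeo X).
Hypothesis Hphi : Cantor_minimal_system phi.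
Variable x0 : X.
Implicit Types (a b g h s m t r : homeo X) (x y u : X).
Implicit Types (B C D G Q V W E : set X).

Let minimal_on := minimal_on phi.
Let square_reduction := square_reduction phi.

(** W is the clopen region used so far. *)
Definition stage W G a :=
  [/\ clopen W, ~ W x0, G `<=` W, G !=set0 & minimal_on G a].

(** D carries the first return map b of a; t moves D to Q, r moves Q to the
    next set G', and so r t conjugates b to the next map a'.  The detour through
    Q makes the supports of the maps t, and likewise those of the maps r,
    disjoint for different steps, although G' will contain the next D. *)
Definition stage_link N W G a G' a' D Q b s m t r :=
  [/\ [/\ clopen D, clopen Q, D `<=` G, Q `<=` N & G' `<=` N],
      [/\ forall x, Q x -> ~ W x, forall x, G' x -> ~ W x
        & forall x, Q x -> ~ G' x],
      [/\ full_group phi t, full_group phi r, supported (D `|` Q) t,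
          supported (Q `|` G') r & forall x, D x <-> G' (r (t x))],
      [/\ full_group phi b, supported D b & square_reduction G a b s m]
    & a' = r * t * b * (r * t)^-1].

(** Four disjoint open sets P1, ..., P4 in N, outside W and not containing x0
    are met by the orbits of u and of a u.  The pieces B and C of D are sent to
    P1 and P2, which gives Q, and from there to P3 and P4, which gives G'. *)
Lemma stage_next W G a N : stage W G a -> nbhs x0 N ->
  exists G' a' D Q b s m t r, stage_link N W G a G' a' D Q b s m t r /\
    stage (W `|` (Q `|` G')) G' a'.
Proof.
move=> [clW Wx0 GW [u Gu] aG] Nx0.
have nWx0 : nbhs x0 (~` W).
  by apply: open_nbhs_nbhs; split=> //; apply: closed_openC; case: clW.
have [N' [clN' N'x0 N'S]] := clopen_nbhs Hphi (filterI Nx0 nWx0).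
have oO : open (N' `\ x0).
  apply: openI; first by case: clN'.
  by apply: closed_openC; apply: accessible_closed_set1;
     apply: hausdorff_accessible; exact: metric_hausdorff.
have O0 : (N' `\ x0) !=set0.
  have [//|y Ny yx0] := @no_isolated_point _ _ _ Hphi x0 N'.
    by apply: open_nbhs_nbhs; split=> //; case: clN'.
  by exists y.
have [O1 [O2 [[clO1 clO2] [O1n O2n] [O1S O2S] O12]]] := split_open Hphi oO O0.
have [P1 [P2 [[c1 c2] [P1n P2n] [P1S P2S] P12]]] := split_open Hphi clO1.1 O1n.
have [P3 [P4 [[c3 c4] [P3n P4n] [P3S P4S] P34]]] := split_open Hphi clO2.1 O2n.
have [h1 fh1 P1u] := full_group_move Hphi u c1.1 P1n.
have [h2 fh2 P2u] := full_group_move Hphi (a u) c2.1 P2n.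
have [h3 fh3 P3u] := full_group_move Hphi u c3.1 P3n.
have [h4 fh4 P4u] := full_group_move Hphi (a u) c4.1 P4n.
have onP (P : set X) z : clopen P -> P z -> nbhs z P.
  by move=> [oP _] Pz; exact: open_nbhs_nbhs.
have [B [C [b [s [m [[clB clC Bu BS CS] BC bD sq]]]]]] :=
  odd_reduction Hphi (V := h1 @^-1` P1 `&` h3 @^-1` P3)
    (V' := h2 @^-1` P2 `&` h4 @^-1` P4) aG Gu
    (filterI (homeo_nbhs (onP _ _ c1 P1u)) (homeo_nbhs (onP _ _ c3 P3u)))
    (filterI (homeo_nbhs (onP _ _ c2 P2u)) (homeo_nbhs (onP _ _ c4 P4u))).
have h1B x : B x -> P1 (h1 x) by move=> /BS[[]].
have h3B x : B x -> P3 (h3 x) by move=> /BS[[]].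
have h2C x : C x -> P2 (h2 x) by move=> /CS[[]].
have h4C x : C x -> P4 (h4 x) by move=> /CS[[]].
have OW x : (N' `\ x0) x -> ~ W x by move=> [/N'S[]].
have P1O : P1 `<=` N' `\ x0 by move=> x /P1S/O1S.
have P2O : P2 `<=` N' `\ x0 by move=> x /P2S/O1S.
have P3O : P3 `<=` N' `\ x0 by move=> x /P3S/O2S.
have P4O : P4 `<=` N' `\ x0 by move=> x /P4S/O2S.
have BW : B `<=` W by move=> x /BS[_ /GW].
have CW : C `<=` W by move=> x /CS[_ /GW].
have [||||t [ft st tB tC]] := double_swap clB clC fh1 fh2 BC.
- by move=> x /h1B/P1O/OW + /BW.
- by move=> x /h2C/P2O/OW + /CW.
- by move=> x /h2C/P2O/OW + /BW.
- by move=> x /h2C P2x /h1B; rewrite homeoVK => /P12.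
pose B1 := (h1^-1)%g @^-1` B; pose C1 := (h2^-1)%g @^-1` C.
have clB1 : clopen B1 by exact: clopen_preimage.
have clC1 : clopen C1 by exact: clopen_preimage.
have B1P x : B1 x -> P1 x by move=> /h1B; rewrite homeoVK.
have C1P x : C1 x -> P2 x by move=> /h2C; rewrite homeoVK.
have [|||||r [fr sr rB rC]] := double_swap clB1 clC1
  (full_groupM fh3 (full_groupV fh1)) (full_groupM fh4 (full_groupV fh2)).
- by move=> x /B1P/P12 nP2 /C1P.
- by move=> x /h3B/P3S + /B1P/P1S/O12.
- by move=> x /h4C/P4S + /C1P/P2S/O12.
- by move=> x /h4C/P4S + /B1P/P1S/O12.
- move=> x /h4C P4x; rewrite invgM invgK /B1 /preimage /mkset homeoM homeoK.
  by move=> /h3B; rewrite homeoVK => /P34.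
pose D := B `|` C; pose Q := B1 `|` C1.
pose G' := (h3^-1)%g @^-1` B `|` (h4^-1)%g @^-1` C.
have clQ : clopen Q by exact: clopenU.
have clG' : clopen G' by apply: clopenU; exact: clopen_preimage.
have G'P x : G' x -> P3 x \/ P4 x.
  by move=> [/h3B|/h4C]; rewrite homeoVK; [left|right].
have QP x : Q x -> P1 x \/ P2 x by move=> [/B1P|/C1P]; [left|right].
have rtB x : B x -> r (t x) = h3 x.
  by move=> Bx; rewrite tB// rB ?homeoM ?homeoK// /B1 /preimage /mkset homeoK.
have rtC x : C x -> r (t x) = h4 x.
  by move=> Cx; rewrite tC// rC ?homeoM ?homeoK// /C1 /preimage /mkset homeoK.
have DG' x : D x <-> G' ((r * t) x).
  rewrite homeoM; split=> [[Bx|Cx]|].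
  - by left; rewrite /preimage /mkset rtB// homeoK.
  - by right; rewrite /preimage /mkset rtC// homeoK.
  have inj y : r (t y) = r (t x) -> y = x by move=> /homeo_inj/homeo_inj.
  case=> [By|Cy].
    by left; rewrite -(inj ((h3^-1)%g (r (t x)))) // rtB// homeoVK.
  by right; rewrite -(inj ((h4^-1)%g (r (t x)))) // rtC// homeoVK.
have srt : supported (Q `|` G') r.
  apply: supportedS sr => x [|[]]; [by left| |].
    move=> Bx; right; left; move: Bx.
    by rewrite /B1 /preimage /mkset invgM invgK homeoM homeoK.
  move=> Cx; right; right; move: Cx.
  by rewrite /C1 /preimage /mkset invgM invgK homeoM homeoK.
have frt : full_group phi (r * t) by exact: full_groupM.
have a'G' : minimal_on G' (r * t * b * (r * t)^-1).
  exact: (minimal_on_conj bD frt DG').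
have QW x : Q x -> ~ W x by move=> /QP[/P1O|/P2O]; exact: OW.
have G'W x : G' x -> ~ W x by move=> /G'P[/P3O|/P4O]; exact: OW.
have [fb clD sb _] := bD.
exists G', (r * t * b * (r * t)^-1), D, Q, b, s, m, t, r; split.
  split=> //; split=> //.
  - by move=> x [/BS[]|/CS[]].
  - by move=> x /QP[/P1O|/P2O] [/N'S[]].
  - by move=> x /G'P[/P3O|/P4O] [/N'S[]].
  - by move=> x /QP[/P1S|/P2S] /O12 nO2 /G'P[/P3S|/P4S].
split=> //.
- by apply: clopenU => //; exact: clopenU.
- case=> // -[/QP[/P1O|/P2O]|/G'P[/P3O|/P4O]] [_]; exact.
- by move=> x G'x; right; right.
- by exists ((r * t) u); apply/DG'; left.
Qed.

End Swindle.

(** * The limit of the swindle *)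

Section SwindleLimit.
Variables (R : realType) (X : metricType R) (phi : homeo X).
Hypothesis Hphi : Cantor_minimal_system phi.
Variable x0 : X.
Implicit Types (a b g h s m t r : homeo X) (x y u : X).
Implicit Types (B C D G Q V W E : set X).

Let stage := stage phi x0.
Let stage_link := stage_link phi.

Lemma stage_sequence (N : nat -> set X) W0 G0 a0 :
  (forall k, nbhs x0 (N k)) -> stage W0 G0 a0 ->
  exists (W G D Q : nat -> set X) (a b s m t r : nat -> homeo X),
  [/\ G 0%N = G0, a 0%N = a0,
      forall k, stage (W k) (G k) (a k),
      forall k, stage_link (N k) (W k) (G k) (a k) (G k.+1) (a k.+1)
        (D k) (Q k) (b k) (s k) (m k) (t k) (r k)
    & forall k, W k.+1 = W k `|` (Q k `|` G k.+1)].
Proof.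
move=> Nx0 st0.
pose T := {p : nat * (set X * set X * homeo X) | stage p.2.1.1 p.2.1.2 p.2.2}.
pose L (p q : T) (e : set X * set X * (homeo X * homeo X * homeo X)
    * (homeo X * homeo X)) :=
  let: (k, (W, G, a)) := sval p in let: (k', (W', G', a')) := sval q in
  let: (D, Q, (b, s, m), (t, r)) := e in
  [/\ k' = k.+1, stage_link (N k) W G a G' a' D Q b s m t r
    & W' = W `|` (Q `|` G')].
have next p : {q | exists e, L p q e}.
  apply: cid; case: p => [[k [[W G] a]] /= st].
  have [G' [a' [D [Q [b [s [m [t [r [link st']]]]]]]]]] :=
    stage_next Hphi st (Nx0 k).
  exists (exist _ (k.+1, (W `|` (Q `|` G'), G', a')) st').
  by exists (D, Q, (b, s, m), (t, r)).
have [f [f0 fL]] := dependent_choice next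
  (exist _ (0%N, (W0, G0, a0)) st0 : T).
have [e eL] := choice fL.
have fk k : (sval (f k)).1 = k.
  elim: k => [|k IH]; first by rewrite f0.
  have := eL k; rewrite /L; case: (sval (f k)) IH => k1 [[W G] a] /= ->.
  case: (sval (f k.+1)) => k2 [[W' G'] a'].
  by case: (e k) => [[[D Q] [[b s] m]] [t r]] [].
exists (fun k => (sval (f k)).2.1.1), (fun k => (sval (f k)).2.1.2).
exists (fun k => (e k).1.1.1), (fun k => (e k).1.1.2).
exists (fun k => (sval (f k)).2.2).
exists (fun k => (e k).1.2.1.1), (fun k => (e k).1.2.1.2).
exists (fun k => (e k).1.2.2), (fun k => (e k).2.1), (fun k => (e k).2.2).
split; [by rewrite f0|by rewrite f0|by move=> k; exact: (svalP (f k))| |] => k;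
  have := eL k; have := fk k; rewrite /L;
  case: (sval (f k)) => k1 [[W G] a] /= ->;
  case: (sval (f k.+1)) => k2 [[W' G'] a'];
  by case: (e k) => [[[D Q] [[b s] m]] [t r]] [].
Qed.

(** Let G k, a k, b k, s k be the data of step k, with a k = b k (s k)^2.  With
    l the product of all a k.+1, and c^-1 the product of all t k followed by
    the product of all r k,
    the conjugate c l c^-1 is the product of all b k.  So a0 l, the product
    of all a k, equals c l c^-1 times the square of the product of all s k. *)
Lemma swindle (N : nat -> set X) W0 E a0 :
  (forall k, nbhs x0 (N k)) -> (forall k, N k `<=` E) ->
  (forall U, nbhs x0 U -> exists K, forall k, (K <= k)%N -> N k `<=` U) ->
  W0 `<=` E -> stage W0 W0 a0 ->
  exists c l s m : homeo X,
  [/\ [/\ full_group phi c, full_group phi l, full_group phi s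
        & full_group phi m],
      [/\ supported E c, supported E l, supported E s & supported E m],
      a0 = c * l * c^-1 * (s * s) * l^-1 & s * m * s = m].
Proof.
move=> Nx0 NE Ncvg W0E st0.
have [W [G [D [Q [a [b [s [m [t [r [G0 a0E st link WS]]]]]]]]]]] :=
  stage_sequence Nx0 st0.
have hX : hausdorff_space X by exact: metric_hausdorff.
have GW k : G k `<=` W k by case: (st k).
have WSk k : W k `<=` W k.+1 by move=> x Wx; rewrite WS; left.
have Wle j k : (j <= k)%N -> W j `<=` W k.
  move=> /subnK <-; elim: (k - j)%N => [//|n IH] x /IH; exact: WSk.
have QW k : Q k `<=` W k.+1 by move=> x Qx; rewrite WS; right; left.
have Wx0 k : ~ W k x0 by case: (st k).
have [DG QN GN] : [/\ forall k, D k `<=` G k, forall k, Q k `<=` N k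
    & forall k, G k.+1 `<=` N k].
  by split=> k; case: (link k) => -[].
have clD k : clopen (D k) by case: (link k) => -[].
have clQ k : clopen (Q k) by case: (link k) => -[].
have clG k : clopen (G k) by case: (st k) => _ _ _ _ [].
have [QnW GnW QnG] : [/\ forall k x, Q k x -> ~ W k x,
    forall k x, G k.+1 x -> ~ W k x & forall k x, Q k x -> ~ G k.+1 x].
  by split=> k; case: (link k) => _ [].
have GE k : G k `<=` E.
  case: k => [|k]; first by move=> x; rewrite G0 => /W0E.
  by move=> x /GN/NE.
have disjP (C : nat -> set X) :
    (forall j k x, (j < k)%N -> C j x -> ~ C k x) ->
    forall j k x, C j x -> C k x -> j = k.
  move=> H j k x Cj Ck; case: (ltngtP j k) => // jk.
    by case: (H _ _ _ jk Cj).
  by case: (H _ _ _ jk Ck).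
have Glt j k x : (j < k)%N -> G j x -> ~ G k x.
  by case: k => // k jk Gj /GnW; apply; apply: (Wle j) => //; exact: GW.
have Gdisj := disjP _ Glt.
have GSdisj j k x : G j.+1 x -> G k.+1 x -> j = k.
  by move=> Gj /(Gdisj _ _ _ Gj)[].
have GSlt j k x : (j < k)%N -> W j.+1 x -> ~ (Q k `|` G k.+1) x.
  by move=> jk /(Wle _ _ jk) Wk [/QnW|/GnW].
have Cr := disjP (fun k => Q k `|` G k.+1).
have Ct := disjP (fun k => D k `|` Q k).
have Crdisj : forall j k x, (Q j `|` G j.+1) x -> (Q k `|` G k.+1) x -> j = k.
  by apply: Cr => j k x jk QG; apply: GSlt jk _; rewrite WS; right.
have Ctdisj : forall j k x, (D j `|` Q j) x -> (D k `|` Q k) x -> j = k.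
  apply: Ct => j k x jk [/DG Gj|Qj] [Dk|Qk].
  - exact: (Glt _ _ _ jk Gj (DG _ _ Dk)).
  - by apply: (QnW _ _ Qk); apply: (Wle j); [exact: ltnW|exact: GW].
  - case: k jk Dk => // k; rewrite ltnS leq_eqVlt => /orP[/eqP<- /DG|jk /DG].
      exact: QnG.
    by move=> /GnW; apply; apply: (Wle j.+1) => //; exact: QW.
  - by apply: (QnW _ _ Qk); apply: (Wle j.+1) => //; exact: QW.
have Gcvg U : nbhs x0 U -> exists K, forall k, (K <= k)%N -> G k `<=` U.
  move=> /Ncvg[K KP]; exists K.+1 => -[//|k] Kk x /GN; exact: KP.
have GScvg U : nbhs x0 U -> exists K, forall k, (K <= k)%N -> G k.+1 `<=` U.
  by move=> /Ncvg[K KP]; exists K => k Kk x /GN; exact: KP.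
have tcvg U : nbhs x0 U -> exists K, forall k, (K <= k)%N -> D k `|` Q k `<=` U.
  move=> Ux; have [K KP] := Gcvg _ Ux; have [K' K'P] := Ncvg _ Ux.
  exists (maxn K K') => k; rewrite geq_max => /andP[Kk K'k] x [/DG|/QN].
    exact: KP.
  exact: K'P.
have rcvg U : nbhs x0 U ->
    exists K, forall k, (K <= k)%N -> Q k `|` G k.+1 `<=` U.
  by move=> /Ncvg[K KP]; exists K => k Kk x [/QN|/GN]; exact: KP.
have fa k : full_group phi (a k) by case: (st k) => _ _ _ _ [].
have sa k : supported (G k) (a k) by case: (st k) => _ _ _ _ [].
have Gx0 k : ~ G k x0 by move=> /GW; exact: Wx0.
have clGW k : clopen (Q k `|` G k.+1) by exact: clopenU.
have clDQ k : clopen (D k `|` Q k) by exact: clopenU.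
have Qx0 k : ~ Q k x0 by move=> /QW; exact: Wx0.
have [ft fr st_ sr] : [/\ forall k, full_group phi (t k),
    forall k, full_group phi (r k),
    forall k, supported (D k `|` Q k) (t k)
    & forall k, supported (Q k `|` G k.+1) (r k)].
  by split=> k; case: (link k) => _ _ [].
have DGrt k x : D k x <-> G k.+1 (r k (t k x)).
  by case: (link k) => _ _ [_ _ _ _].
have sb k : supported (D k) (b k) by case: (link k) => _ _ _ [].
have aS k : a k.+1 = r k * t k * b k * (r k * t k)^-1.
  by case: (link k).
have [fs fm ss sm] : [/\ forall k, full_group phi (s k),
    forall k, full_group phi (m k), forall k, supported (G k) (s k)
    & forall k, supported (G k) (m k)].
  by split=> k; case: (link k) => _ _ _ [_ _ [[? ?] [? ?]]].
have [aE smE] : (forall k, a k = b k * (s k * s k)) /\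
    forall k, s k * m k * s k = m k.
  by split=> k; case: (link k) => _ _ _ [_ _ []].
have [|l [fl lE l0]] := @infinite_prod_exists _ phi x0
  (fun k => G k.+1) (fun k => a k.+1) hX (fun k => clG k.+1) _ GSdisj GScvg
  (fun k => fa k.+1) (fun k => sa k.+1); first by [].
have [S [fS SE S0]] := infinite_prod_exists hX clG Gx0 Gdisj Gcvg fs ss.
have [M [fM ME M0]] := infinite_prod_exists hX clG Gx0 Gdisj Gcvg fm sm.
have [|T [fT TE T0]] := infinite_prod_exists hX clDQ _ Ctdisj tcvg ft st_.
  by move=> k [/DG|]; [exact: Gx0|exact: Qx0].
have [|P [fP PE P0]] := infinite_prod_exists hX clGW _ Crdisj rcvg fr sr.
  by move=> k [|]; [exact: Qx0|exact: Gx0].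
(* A point of D k that t k left outside Q k and G k.+1 would be fixed by r k,
   but r k t k maps D k into G k.+1. *)
have PTE k x : D k x -> P (T x) = r k (t k x).
  move=> Dx; rewrite (TE k); last by left.
  rewrite (PE k)//; apply: contrapT => n.
  have /DGrt := Dx; rewrite (sr k)// => G'; apply: (n); by right.
pose c := (P * T)^-1.
have conjD k x : D k x -> (c * l * c^-1) x = b k x.
  move=> Dx; apply: (@homeo_inj _ (P * T)).
  rewrite /c invgK !homeoM -[P (T _)]homeoM homeoVK.
  rewrite (PTE _ _ Dx) (lE k); last exact/DGrt.
  have Dbx : D k (b k x) by exact: supported_stable.
  by rewrite (PTE _ _ Dbx) aS !homeoM -[r k (t k x)]homeoM homeoK.
have conj0 x : (forall k, ~ D k x) -> (c * l * c^-1) x = x.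
  move=> nD; apply: (@homeo_inj _ (P * T)).
  rewrite /c invgK !homeoM -[P (T (_ _))]homeoM homeoVK l0// => k Gx.
  have [y yE] : exists y, P (T x) = r k (t k y).
    by exists (((r k * t k)^-1)%g (P (T x))); rewrite -[RHS]homeoM homeoVK.
  have Dy : D k y by apply/DGrt; rewrite -yE.
  apply: (nD k); suff -> : x = y by [].
  by apply/(@homeo_inj _ T)/(@homeo_inj _ P); rewrite (PTE _ _ Dy).
have conjG k x : G k x -> (c * l * c^-1) x = b k x.
  move=> Gx; case: (pselect (D k x)) => Dx; first exact: conjD.
  rewrite sb// conj0// => j Dj.
  by apply: Dx; rewrite (Gdisj k j x)//; exact: DG.
have suppE (C : nat -> set X) (F : homeo X) : (forall k, C k `<=` E) ->
    (forall x, (forall k, ~ C k x) -> F x = x) -> supported E F.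
  by move=> CE F0 x nE; apply: F0 => k /CE.
have sT : supported E T.
  by apply: (suppE _ _ _ T0) => k x [/DG/GE|/QN/NE].
have sP : supported E P.
  by apply: (suppE _ _ _ P0) => k x [/QN/NE|/GE].
exists c, l, S, M; split.
- by split=> //; apply: full_groupV; exact: full_groupM.
- split.
  + by apply: supportedV; exact: supportedM.
  + by apply: (suppE _ _ _ l0) => k; exact: GE.
  + exact: (suppE _ _ GE S0).
  + exact: (suppE _ _ GE M0).
- suff <- : a0 * l = c * l * c^-1 * (S * S) by rewrite -mulgA mulgV mulg1.
  apply: homeoP => x; rewrite homeoM [RHS]homeoM.
  case: (pselect (exists k, G k x)) => [[k Gx]|nG]; last first.
    have nGk k : ~ G k x by move=> Gk; apply: nG; exists k.
    rewrite l0// homeoM !S0// conj0; last by move=> k /DG/nGk.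
    by rewrite -a0E sa.
  have Gsx : G k (s k x) by exact: supported_stable.
  have Gssx : G k (s k (s k x)) by exact: supported_stable.
  rewrite homeoM (SE _ _ Gx) (SE _ _ Gsx) (conjG _ _ Gssx).
  transitivity (a k x); last by rewrite aE !homeoM.
  case: k Gx {Gsx Gssx} => [|k] Gx.
    by rewrite l0 ?a0E// => k /(Gdisj _ _ _ Gx).
  rewrite (lE _ _ Gx) -a0E sa// => G0x.
  by have := Gdisj _ _ _ G0x (supported_stable (sa k.+1) Gx).
- apply: homeoP => x; rewrite !homeoM.
  case: (pselect (exists k, G k x)) => [[k Gx]|nG]; last first.
    have nGk k : ~ G k x by move=> Gk; apply: nG; exists k.
    by rewrite (S0 _ nGk) (M0 _ nGk) (S0 _ nGk).
  have Gsx : G k (s k x) by exact: supported_stable.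
  have Gmsx : G k (m k (s k x)) by exact: supported_stable.
  by rewrite (SE _ _ Gx) (ME _ _ Gsx) (SE _ _ Gmsx) (ME _ _ Gx) -[in RHS]smE.
Qed.

End SwindleLimit.

(** * Products of two involutions with a common support *)

Section Involutions.
Variables (X : topologicalType) (phi : homeo X).
Implicit Types (f g h p r c k a b u : homeo X) (x y : X) (A C S : set X).

Definition dihedral_on S g := exists a b : homeo X,
  [/\ full_group phi a /\ full_group phi b, a * a = 1 /\ b * b = 1,
      supp a = S, supp b = S & g = a * b].

Definition three_involutions g := exists i1 i2 i3 : homeo X,
    [/\ [/\ full_group phi i1, full_group phi i2 & full_group phi i3],
        [/\ involution i1, involution i2 & involution i3],
        [/\ clopen (supp i1), clopen (supp i2) & clopen (supp i3)]
      & g = i1 * i2 * i3].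

Lemma supp_supported f : supported (supp f) f.
Proof. by move=> x nfx; apply: contrapT => /nfx. Qed.

Lemma supp_stable f x : supp f x -> supp f (f x).
Proof. exact: (supported_stable (@supp_supported f)). Qed.

Lemma suppM_disjoint f g : (forall x, supp f x -> ~ supp g x) ->
  supp (f * g) = supp f `|` supp g.
Proof.
move=> fg; apply/seteqP; split=> [x|x [fx|gx]]; rewrite /supp /mkset homeoM.
- move=> ne; case: (pselect (supp g x)) => gx; first by right.
  by left => fx; apply: ne; rewrite (supp_supported gx) fx.
- by rewrite (supp_supported (fg _ fx)); exact: fx.
- rewrite (@supp_supported f (g x)); first exact: gx.
  by move=> /fg; apply; exact: supp_stable.
Qed.

Lemma dihedral_onU S S' g g' : (forall x, S x -> ~ S' x) ->
  dihedral_on S g -> dihedral_on S' g' -> dihedral_on (S `|` S') (g * g').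
Proof.
move=> SS' [a [b [[fa fb] [aa bb] sa sb ->]]].
move=> [a' [b' [[fa' fb'] [aa' bb'] sa' sb' ->]]].
have comm f f' : supp f = S -> supp f' = S' -> f * f' = f' * f.
  move=> sf sf'.
  apply: supported_commute (@supp_supported f) (@supp_supported f') _.
  by rewrite sf sf'.
exists (a * a'), (b * b'); split.
- by split; exact: full_groupM.
- rewrite {1}(comm _ _ sa sa') {1}(comm _ _ sb sb'); split.
    by rewrite -mulgA (mulgA a) aa mul1g aa'.
  by rewrite -mulgA (mulgA b) bb mul1g bb'.
- by rewrite suppM_disjoint ?sa ?sa'.
- by rewrite suppM_disjoint ?sb ?sb'.
by rewrite -!mulgA (mulgA b) (comm _ _ sb sa') !mulgA.
Qed.

Lemma swap_supp C h (t : homeo X) : (forall x, C x -> ~ C (h x)) ->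
  (forall x, C x -> t x = h x) -> (forall x, C x -> t (h x) = x) ->
  (forall x, ~ C x -> ~ C ((h^-1)%g x) -> t x = x) ->
  supp t = C `|` (h^-1)%g @^-1` C.
Proof.
move=> Ch t1 t2 t3; apply/seteqP; split=> x.
  move=> tx; case: (pselect (C x)) => Cx; first by left.
  by right; apply: contrapT => Chx; apply: tx; exact: t3.
case=> [Cx|]; rewrite /supp /mkset.
  by rewrite t1// => hx; apply: (Ch _ Cx); rewrite hx.
rewrite /preimage /mkset => Cx; rewrite -[in t x](homeoVK h x) t2// => hx.
by apply: (Ch _ Cx); rewrite homeoVK -hx.
Qed.

(** Exchanging A and C first by h and then by h p^-1 results in p on A and in
    h p^-1 h^-1 on C. *)
Lemma dihedral_mirror A C p h : clopen A -> (forall x, A x -> ~ C x) ->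
  full_group phi p -> full_group phi h -> supported A p ->
  (forall x, A x <-> C (h x)) -> dihedral_on (A `|` C) (p * (h * p^-1 * h^-1)).
Proof.
move=> clA AC fp fh sp hAC.
have hC x : A ((h^-1)%g x) <-> C x by rewrite hAC homeoVK.
have sp' := supportedV sp.
have hpAC x : A x <-> C ((h * p^-1) x).
  rewrite homeoM -hAC; split; first exact: supported_stable.
  by move=> /(supported_stable sp); rewrite homeoVK.
have Ah x : A x -> ~ A (h x) by move=> /hAC Ch /AC.
have Ahp x : A x -> ~ A ((h * p^-1) x) by move=> /hpAC Ch /AC.
have fhp : full_group phi (h * p^-1).
  by apply: full_groupM => //; exact: full_groupV.
have [b [fb bb b1 b2 b3]] := swap_exists clA fh Ah.
have [a [fa aa a1 a2 a3]] := swap_exists clA fhp Ahp.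
have setE g : (forall x, A x <-> C (g x)) -> (g^-1)%g @^-1` A = C.
  by move=> gAC; apply/seteqP; split=> x; rewrite /preimage /mkset gAC homeoVK.
exists a, b; split=> //.
- by rewrite (swap_supp Ahp a1 a2 a3) setE.
- by rewrite (swap_supp Ah b1 b2 b3) setE.
apply: homeoP => x; rewrite [LHS]homeoM [RHS]homeoM !homeoM.
case: (pselect (A x)) => Ax.
  have nA : ~ A ((h^-1)%g x) by rewrite hC; exact: AC.
  rewrite sp'// homeoVK b1//.
  have Apx := supported_stable sp Ax.
  have -> : h x = (h * p^-1) (p x) by rewrite homeoM homeoK.
  by rewrite a2.
case: (pselect (C x)) => Cx; last first.
  have nA : ~ A ((h^-1)%g x) by rewrite hC.
  rewrite sp'// homeoVK sp// b3// a3// invgM invgK homeoM => Ap.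
  by apply: nA; rewrite -(homeoK p ((h^-1)%g x)); exact: supported_stable.
have Ahx : A ((h^-1)%g x) by rewrite hC.
have -> : b x = (h^-1)%g x by rewrite -[in LHS](homeoVK h x) b2.
rewrite a1// homeoM sp// => /AC; apply.
by apply/hAC; exact: supported_stable.
Qed.

(** Write g = a b and c = r b r, which has its support in r S, disjoint from S.
    Then r exchanges b and c by conjugation, so b c r is an involution, and
    g r r' = (a c) (b c r) r'.  The support of b c r is that of r, because
    off S and r S it is r, and it exchanges S with r S. *)
Lemma dihedral_times_reflections S g r r' : clopen S -> dihedral_on S g ->
  full_group phi r -> full_group phi r' -> r * r = 1 -> r' * r' = 1 ->
  clopen (supp r) -> clopen (supp r') -> (forall x, S x -> ~ S (r x)) ->
  three_involutions (g * (r * r')).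
Proof.
move=> clS [a [b [[fa fb] [aa bb] sa sb ->]]] fr fr' rr r'r' cr cr' Sr.
have rK x : r (r x) = x by rewrite -homeoM rr.
have [c cE] : exists c, c = r * b * r by exists (r * b * r).
have cc : c * c = 1.
  by rewrite cE -!mulgA (mulgA r r) rr mul1g (mulgA b b) bb mul1g.
have fc : full_group phi c.
  by rewrite cE; apply: full_groupM => //; exact: full_groupM.
have sc : supp c = r @^-1` S.
  apply/seteqP; split=> x; rewrite -sb /supp /preimage /mkset cE !homeoM.
    by move=> ne e; apply: ne; rewrite e.
  by move=> ne e; apply: ne; apply: (@homeo_inj _ r); rewrite e rK.
have disj x : S x -> ~ (r @^-1` S) x by exact: Sr.
have comm f : supp f = S -> f * c = c * f.
  move=> sf; apply: (supported_commute (@supp_supported f) (@supp_supported c)).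
  by rewrite sf sc.
have rbr : r * b = c * r by rewrite cE -!mulgA rr mulg1.
have rcr : r * c = b * r by rewrite cE !mulgA rr mul1g.
exists (a * c), (b * c * r), r'; split.
- split=> //; first exact: full_groupM.
  by apply: full_groupM => //; exact: full_groupM.
- rewrite /involution !expgS !expg0 !mulg1; split=> //.
    by rewrite {1}(comm _ sa) -mulgA (mulgA a) aa mul1g cc.
  rewrite -!mulgA (mulgA r b) rbr -!mulgA (mulgA r c) rcr.
  by rewrite -!mulgA rr mulg1 (mulgA c c) cc mul1g bb.
- split=> //.
    rewrite suppM_disjoint sa sc//; apply: clopenU => //.
    exact: clopen_preimage.
  suff -> : supp (b * c * r) = supp r by [].
  have sb' : supported S b by rewrite -sb; exact: supp_supported.
  have sc' : supported (r @^-1` S) c by rewrite -sc; exact: supp_supported.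
  apply/seteqP; split=> x; rewrite /supp /mkset !homeoM.
    move=> ne rx; apply: ne; rewrite rx.
    rewrite sc' ?sb'// => [Sx|]; last by rewrite /preimage /mkset rx => Sx;
      apply: (Sr _ Sx); rewrite rx.
    by apply: (Sr _ Sx); rewrite rx.
  move=> ne; case: (pselect (S x)) => Sx.
    have Sc : (r @^-1` S) (c (r x)).
      by apply: supported_stable => //; rewrite /preimage /mkset rK.
    by rewrite sb' => [|/Sr//] e; apply: (Sr _ Sx); rewrite -e.
  case: (pselect (S (r x))) => Srx; last first.
    rewrite sc'; last by rewrite /preimage /mkset rK.
    by rewrite sb'.
  rewrite sc'; last by rewrite /preimage /mkset rK.
  by move=> e; apply: Sx; rewrite -e; exact: supported_stable.
- rewrite -[a * c * _]mulgA (mulgA c) (mulgA c) -(comm b sb).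
  by rewrite -(mulgA b c c) cc mulg1 !mulgA.
Qed.

Lemma three_involutions_conj u g :
  full_group phi u -> three_involutions g ->
  three_involutions (u * g * u^-1).
Proof.
move=> fu [i1 [i2 [i3 [[f1 f2 f3] [v1 v2 v3] [c1 c2 c3] ->]]]].
have fJ i : full_group phi i -> full_group phi (u * i * u^-1).
  by move=> fi; apply: full_groupM; [exact: full_groupM|exact: full_groupV].
have vJ i : involution i -> involution (u * i * u^-1).
  rewrite /involution !expgS !expg0 !mulg1 => ii.
  by rewrite -!mulgA (mulgA u^-1 u) mulVg mul1g (mulgA i i) ii mul1g mulgV.
have cJ i : clopen (supp i) -> clopen (supp (u * i * u^-1)).
  move=> ci; suff -> : supp (u * i * u^-1) = (u^-1)%g @^-1` supp i.
    exact: clopen_preimage.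
  apply/seteqP; split=> x; rewrite /supp /preimage /mkset !homeoM => ne e;
    apply: ne; first by rewrite e homeoVK.
  by apply: (@homeo_inj _ u); rewrite homeoVK.
exists (u * i1 * u^-1), (u * i2 * u^-1), (u * i3 * u^-1); split.
- by split; exact: fJ.
- by split; exact: vJ.
- by split; exact: cJ.
by rewrite -!mulgA !(mulgA u^-1 u) mulVg !mul1g.
Qed.

End Involutions.

(** * Spreading a word over the levels of a tower *)

Section Levels.
Variables (X : topologicalType) (phi rho : homeo X) (E : set X).
Hypotheses (frho : full_group phi rho) (clE : clopen E).
Implicit Types (f g h c k s m p y : homeo X) (x z : X).

Definition level (j : nat) : set X := ((rho ^+ j)^-1)%g @^-1` E.

Hypothesis level_disjoint : forall i j x, (i < 6)%N -> (j < 6)%N ->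
  level i x -> level j x -> i = j.

Definition lift_level (j : nat) g := rho ^+ j * g * (rho ^+ j)^-1.

Lemma level_clopen j : clopen (level j).
Proof. exact: clopen_preimage. Qed.

Lemma lift_levelM j f g :
  lift_level j (f * g) = lift_level j f * lift_level j g.
Proof. by rewrite /lift_level !mulgA mulgVK. Qed.

Lemma lift_level_full j g : full_group phi g -> full_group phi (lift_level j g).
Proof.
move=> fg; have fX := full_groupX j frho.
by apply: full_groupM; [exact: full_groupM|exact: full_groupV].
Qed.

Lemma lift_level_supported j g :
  supported E g -> supported (level j) (lift_level j g).
Proof. by move=> sg x nE; rewrite /lift_level !homeoM sg// homeoVK. Qed.

Lemma dihedral_levels i j c k : (i < 6)%N -> (j < 6)%N -> i != j ->
  full_group phi c -> full_group phi k -> supported E c -> supported E k ->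
  dihedral_on phi (level i `|` level j)
    (lift_level i c * lift_level j (k * c^-1 * k^-1)).
Proof.
move=> i6 j6 ij fc fk sc sk.
pose h := rho ^+ j * k * (rho ^+ i)^-1.
have fi := full_groupX i frho; have fj := full_groupX j frho.
have -> : lift_level j (k * c^-1 * k^-1) = h * (lift_level i c)^-1 * h^-1.
  by rewrite /h /lift_level !invgM !invgK !mulgA !mulgVK.
apply: dihedral_mirror.
- exact: level_clopen.
- by move=> x xi xj; case/eqP: ij; exact: level_disjoint xi xj.
- exact: lift_level_full.
- by apply: full_groupM; [exact: full_groupM|exact: full_groupV].
- exact: lift_level_supported.
move=> x; rewrite /level /preimage /mkset /h !homeoM homeoK.
split; first exact: supported_stable.
by move=> /(supported_stable (supportedV sk)); rewrite homeoK.
Qed.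

Definition below (k : nat) : set X :=
  [set x | exists2 i, (i < k)%N & level i x].

(** Conjugating by f on level k moves the factor f, which comes after g on that
    level, past rho to level k + 1. *)
Lemma gauge_step (k : nat) p f g : (k < 6)%N ->
  full_group phi f -> supported E f -> supported E g ->
  supported (below k) p ->
  supported (below k.+1) (p * lift_level k g) /\
  exists2 u, full_group phi u & p * lift_level k (f * g) * rho =
    u * (p * lift_level k g * lift_level k.+1 f * rho) * u^-1.
Proof.
move=> k6 ff sf sg sp; split.
  apply: supportedM.
    by apply: supportedS sp => x [i ik xi]; exists i => //; exact: ltnW.
  by apply: supportedS (lift_level_supported (j := k) sg) => x xk; exists k.
exists (lift_level k f); first exact: lift_level_full.
have comm : p * lift_level k f = lift_level k f * p.
  apply: (supported_commute sp (lift_level_supported (j := k) sf)).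
  move=> x [i ik xi] xk; have := level_disjoint (ltn_trans ik k6) k6 xi xk.
  by move=> e; rewrite e ltnn in ik.
have rf : lift_level k.+1 f * rho = rho * lift_level k f.
  by rewrite /lift_level expgS invgM !mulgA mulgVK.
rewrite lift_levelM; move: comm rf.
move: (lift_level k f) (lift_level k g) (lift_level k.+1 f) => F G F' comm rf.
by rewrite -(mulgA _ F' rho) rf !mulgA mulgK comm.
Qed.

Definition label y := full_group phi y /\ supported E y.

Lemma spread_over_levels y0 y1 y2 y3 y4 y5 :
  label y0 -> label y1 -> label y2 -> label y3 -> label y4 -> label y5 ->
  exists2 u, full_group phi u & y5 * y4 * y3 * y2 * y1 * y0 * rho =
    u * (lift_level 0 y0 * lift_level 1 y1 * lift_level 2 y2 *
         lift_level 3 y3 * lift_level 4 y4 * lift_level 5 y5 * rho) * u^-1.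
Proof.
move=> [f0 s0] [f1 s1] [f2 s2] [f3 s3] [f4 s4] [f5 s5].
pose fM := @full_groupM _ phi; pose sM := @supportedM _ E.
have s1' : supported (below 0) (1 : homeo X) by [].
have [t1 [u1 fu1 e1]] := @gauge_step 0 1 (y5 * y4 * y3 * y2 * y1) y0 isT
  (fM _ _ (fM _ _ (fM _ _ (fM _ _ f5 f4) f3) f2) f1)
  (sM _ _ (sM _ _ (sM _ _ (sM _ _ s5 s4) s3) s2) s1) s0 s1'.
have [t2 [u2 fu2 e2]] := @gauge_step 1 _ (y5 * y4 * y3 * y2) y1 isT
  (fM _ _ (fM _ _ (fM _ _ f5 f4) f3) f2)
  (sM _ _ (sM _ _ (sM _ _ s5 s4) s3) s2) s1 t1.
have [t3 [u3 fu3 e3]] := @gauge_step 2 _ (y5 * y4 * y3) y2 isT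
  (fM _ _ (fM _ _ f5 f4) f3) (sM _ _ (sM _ _ s5 s4) s3) s2 t2.
have [t4 [u4 fu4 e4]] := @gauge_step 3 _ (y5 * y4) y3 isT
  (fM _ _ f5 f4) (sM _ _ s5 s4) s3 t3.
have [_ [u5 fu5 e5]] := @gauge_step 4 _ y5 y4 isT f5 s5 s4 t4.
exists (u1 * u2 * u3 * u4 * u5); first by do ! apply: full_groupM.
have -> : y5 * y4 * y3 * y2 * y1 * y0 * rho =
    1 * lift_level 0 (y5 * y4 * y3 * y2 * y1 * y0) * rho.
  by rewrite mul1g /lift_level expg0 invg1 mul1g mulg1.
by rewrite e1 e2 e3 e4 e5 !mul1g !invgM !mulgA.
Qed.

End Levels.

(** * The decomposition of a minimal homeomorphism *)

Section ShrinkingNeighborhoods.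
Import Order.TTheory GRing.Theory Num.Theory.
Local Open Scope ring_scope.

Lemma shrinking_nbhds (R : realType) (X : metricType R) (x0 : X) E :
  nbhs x0 E -> exists N : nat -> set X,
    [/\ forall k, nbhs x0 (N k), forall k, N k `<=` E
    & forall U, nbhs x0 U -> exists K, forall k, (K <= k)%N -> N k `<=` U].
Proof.
move=> Ex0; exists (fun k => ball x0 k.+1%:R^-1 `&` E); split.
- by move=> k; apply: filterI => //; apply: nbhsx_ballx; rewrite invr_gt0.
- by move=> k x [].
move=> U /nbhs_ballP[e /= e0 eU]; exists (Num.truncn e^-1) => k Kk x [xk _].
apply: eU; apply: le_ball xk; rewrite invf_ple ?posrE//.
apply: le_trans (_ : (Num.truncn e^-1).+1%:R <= _); last by rewrite ler_nat.
exact/ltW/truncnS_gt.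
Qed.

End ShrinkingNeighborhoods.

Section Assembly.
Variables (R : realType) (X : metricType R) (phi : homeo X).
Hypothesis Hphi : Cantor_minimal_system phi.
Implicit Types (x y : X) (U V E : set X).

(** The finite orbit of a periodic point would miss a nonempty open set, since
    no point is isolated. *)
Lemma aperiodic n x : (0 < n)%N -> (phi ^+ n)%g x <> x.
Proof.
move=> n0 per.
have [O [oO O0 On]] : exists O, [/\ open O, O !=set0 &
    forall j, (j < n)%N -> ~ O ((phi ^+ j)%g x)].
  elim: {per} n {n0} => [|n [O [oO [z Oz] On]]].
    exists setT; split=> //; first exact: openT.
    by exists x.
  have hX : hausdorff_space X by exact: metric_hausdorff.
  exists (O `\ (phi ^+ n)%g x); split.
  - apply: openI => //; apply: closed_openC.
    exact/accessible_closed_set1/hausdorff_accessible.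
  - case: (pselect (z = (phi ^+ n)%g x)) => [zE|zne]; last by exists z.
    have [y Oy yz] := no_isolated_point Hphi (open_nbhs_nbhs (conj oO Oz)).
    by exists y; split=> //; rewrite -zE.
  - move=> j; rewrite ltnS leq_eqVlt => /orP[/eqP-> [_ /(_ erefl)]//|/On nO].
    by case=> /nO.
have [N /(_ x I)[m [_ _ Om]]] := syndetic_self Hphi oO O0 (@subsetT _ _).
have perq q : (phi ^+ (q * n))%g x = x.
  by elim: q => // q IH; rewrite mulSn homeoXD IH.
apply: (On (m %% n)%N); first by rewrite ltn_mod.
by move: Om; rewrite {1}(divn_eq m n) addnC homeoXD perq.
Qed.

Lemma tall_clopen_nbhs x n : exists E, [/\ clopen E, E x &
  forall y i, E y -> (0 < i < n)%N -> ~ E ((phi ^+ i)%g y)].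
Proof.
elim: n => [|n [E [clE Ex En]]].
  by exists setT; split=> // [|y i _]; [exact: clopenT|rewrite ltn0 andbF].
case: n En => [|n] En.
  by exists E; split=> // y [|i].
have [U [V [cU cV Ux Vx UV]]] :=
  clopen_separate Hphi (not_eq_sym (aperiodic (x := x) (ltn0Sn n))).
exists (E `&` (U `&` (phi ^+ n.+1)%g @^-1` V)); split.
- by apply: clopenI => //; apply: clopenI => //; exact: clopen_preimage.
- by [].
move=> y i [Ey [Uy Vy]] /andP[i0]; rewrite ltnS leq_eqVlt => /orP[/eqP->|i_n].
  by case=> _ [/UV + _]; exact.
by case=> + _; apply: En => //; rewrite i0.
Qed.

Lemma minimal_three_involutions : three_involutions phi phi.
Proof.
have [[[x0 _] _ _ _] _] := Hphi.
have [E [clE Ex0 tall]] := tall_clopen_nbhs x0 12.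
have hX : hausdorff_space X by exact: metric_hausdorff.
have openx x : open (~` [set x]).
  apply: closed_openC; apply: accessible_closed_set1.
  exact: hausdorff_accessible.
have fphi := full_group_self phi.
have sphi : supported setT phi by move=> x /(_ I).
have aphi := syndetic_self Hphi.
have E0 : E !=set0 by exists x0.
have ET : E `<=` setT by [].
have [r1 [r2 [f [[fr1 fr2 ff] [r11 r22 phiE] [cr1 cr2 sf af] r1E rhoE]]]] :=
  tower_reflections fphi clopenT sphi aphi clE ET E0.
have frho := full_groupM fr1 fr2.
(* Below the top of a column rho acts as phi, so the levels of rho that are
   used here consist of points at constant height. *)
have tallE d n : E d -> return_time phi E d n -> (12 <= n)%N.
  move=> Ed [n0 Dn _]; rewrite leqNgt; apply/negP => n12.
  by apply: (tall d n) => //; rewrite n0.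
have rhoX d n j : E d -> return_time phi E d n -> (j < n)%N ->
    ((r1 * r2) ^+ j)%g d = (phi ^+ j)%g d.
  move=> Ed rd; elim: j => // j IH jn.
  rewrite homeoXS IH; last exact: ltnW.
  by rewrite (rhoE _ d n j)//; split=> //; exact: ltnW.
have levelP x j : (j < 12)%N -> level (r1 * r2) E j x ->
    exists d n, column phi E x d n j.
  rewrite /level /preimage /mkset; set d := (X in E X) => j12 Ed.
  have [n rd] : exists n, return_time phi E d n.
    exact: (return_time_total aphi clE ET E0).
  exists d, n; have := tallE _ _ Ed rd => n12.
  split=> //; first exact: leq_trans n12.
  rewrite -(rhoX d n)//; last exact: leq_trans n12.
  by rewrite /d homeoVK.
have level_disjoint i j x : (i < 6)%N -> (j < 6)%N ->
    level (r1 * r2) E i x -> level (r1 * r2) E j x -> i = j.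
  move=> i6 j6 /levelP[|d [n c]]; first by lia.
  by move=> /levelP[|d' [n' c']]; [lia|case: (column_uniq c c')].
have level_mirror i j x : (i < 6)%N -> (j < 6)%N ->
    level (r1 * r2) E i x -> ~ level (r1 * r2) E j (r1 x).
  move=> i6 j6 /levelP[|d [n c]]; first by lia.
  move=> /levelP[|d' [n' c']]; first by lia.
  case: (c) => Ed rd jn _; have n12 := tallE _ _ Ed rd.
  have c1 : column phi E (r1 x) d n (n.-1 - i).
    by rewrite (r1E _ _ _ _ c); split=> //; lia.
  by have [_ _] := column_uniq c1 c'; lia.
(* The swindle near x0 has to start from a set that does not contain x0. *)
have mf : minimal_on phi E f by split=> //; case: clE.
have [u [Eu ux0 fux0]] : exists u, [/\ E u, u <> x0 & f u <> x0].
  have oO : open (E `\ x0) by apply: openI; [case: clE|exact: openx].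
  have O0 : (E `\ x0) !=set0.
    have [y Ey yx0] := no_isolated_point Hphi (open_nbhs_nbhs (conj clE.1 Ex0)).
    by exists y.
  have [O1 [O2 [_ [[v1 Ov1] [v2 Ov2]] [O1S O2S] O12]]] := split_open Hphi oO O0.
  case: (pselect (f v1 = x0)) => fv1.
    exists v2; have [Ev2 v2x0] := O2S _ Ov2; split=> // fv2.
    apply: (O12 _ Ov1); suff -> : v1 = v2 by [].
    by apply: (@homeo_inj _ f); rewrite fv1.
  by exists v1; have [Ev1 v1x0] := O1S _ Ov1.
have [B [C [f' [s0 [m0 [[clB clC Bu BS CS] _ mf' sq]]]]]] :=
  odd_reduction Hphi mf Eu (open_nbhs_nbhs (conj (openx x0) ux0))
    (open_nbhs_nbhs (conj (openx x0) fux0)).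
have [[fs0 fm0] [ss0 sm0] fE sms0] := sq.
have st : stage phi x0 (B `|` C) (B `|` C) f'.
  split=> //; [exact: clopenU| |by exists u; left].
  by case=> [/BS[]|/CS[]] nx0 _; exact: nx0.
have [N [Nx0 NE Ncvg]] := shrinking_nbhds (open_nbhs_nbhs (conj clE.1 Ex0)).
have WE : B `|` C `<=` E by move=> x [/BS[]|/CS[]].
have [c [l [s [m [[fc fl fs fm] [sc sl ss sm] f'E sms]]]]] :=
  swindle Hphi Nx0 NE Ncvg WE st.
have mirror_sqrt (g k : homeo X) : k * g * k = g -> k = g * k^-1 * g^-1.
  move=> e; have : k * g = g * k^-1 by rewrite -[in RHS]e mulgK.
  by move=> <-; rewrite mulgK.
have fl' := full_groupV fl; have sl' := supportedV sl.
have fy5 : full_group phi (c * l * c^-1).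
  by apply: full_groupM; [exact: full_groupM|exact: full_groupV].
have s5 : supported E (c * l * c^-1).
  by apply: supportedM; [exact: supportedM|exact: supportedV].
have [v fv vE] := spread_over_levels frho level_disjoint
  (conj fs0 ss0) (conj fs0 ss0) (conj fl' sl') (conj fs ss) (conj fs ss)
  (conj fy5 s5).
have phiE' : phi = c * l * c^-1 * s * s * l^-1 * s0 * s0 * (r1 * r2).
  by rewrite [LHS]phiE fE f'E !mulgA.
rewrite [X in three_involutions _ X]phiE' vE.
apply: three_involutions_conj => //.
pose lv j (g : homeo X) := lift_level (r1 * r2) j g.
have lvS j (g : homeo X) :
    supported E g -> supported (level (r1 * r2) E j) (lv j g).
  exact: lift_level_supported.
pose S := (level (r1 * r2) E 0 `|` level (r1 * r2) E 1) `|`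
  ((level (r1 * r2) E 2 `|` level (r1 * r2) E 5) `|`
   (level (r1 * r2) E 3 `|` level (r1 * r2) E 4)).
have ne i j x : (i < 6)%N -> (j < 6)%N -> i != j ->
    level (r1 * r2) E i x -> ~ level (r1 * r2) E j x.
  by move=> i6 j6 /eqP ij xi xj; apply: ij; exact: level_disjoint xi xj.
have dih : dihedral_on phi S ((lv 0%N s0 * lv 1%N s0) *
    ((lv 2 l^-1 * lv 5 (c * l * c^-1)) * (lv 3 s * lv 4 s))).
  apply: dihedral_onU.
  - by move=> x [] xi [[|]|[|]]; apply: ne xi.
  - rewrite [X in lv 1%N X](mirror_sqrt _ _ sms0).
    exact: (dihedral_levels frho clE level_disjoint).
  apply: dihedral_onU.
  - by move=> x [] xi [|]; apply: ne xi.
  - rewrite -[in X in lv 5 X](invgK l).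
    exact: (dihedral_levels frho clE level_disjoint).
  rewrite [X in lv 4 X](mirror_sqrt _ _ sms).
  exact: (dihedral_levels frho clE level_disjoint).
have clS : clopen S by do ! [apply: clopenU]; exact: level_clopen.
have Sr x : S x -> ~ S (r1 x).
  by move=> [[|]|[[|]|[|]]] xi [[|]|[[|]|[|]]]; exact: level_mirror xi.
suff -> : lift_level (r1 * r2) 0 s0 * lift_level (r1 * r2) 1 s0 *
    lift_level (r1 * r2) 2 l^-1 * lift_level (r1 * r2) 3 s *
    lift_level (r1 * r2) 4 s * lift_level (r1 * r2) 5 (c * l * c^-1) =
    (lv 0%N s0 * lv 1%N s0) *
    ((lv 2 l^-1 * lv 5 (c * l * c^-1)) * (lv 3 s * lv 4 s)).
  exact: (dihedral_times_reflections clS dih fr1 fr2 r11 r22 cr1 cr2 Sr).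
have comm : lv 5 (c * l * c^-1) * (lv 3 s * lv 4 s) =
    lv 3 s * lv 4 s * lv 5 (c * l * c^-1).
  apply: (supported_commute (lvS 5 _ s5)).
    apply: (@supportedM _ (level (r1 * r2) E 3 `|` level (r1 * r2) E 4)).
      by apply: supportedS (lvS 3 _ ss); left.
    by apply: supportedS (lvS 4 _ ss); right.
  by move=> x xi [|]; apply: ne xi.
rewrite -/(lv 0%N s0) -/(lv 1%N s0) -/(lv 2 l^-1) -/(lv 3 s) -/(lv 4 s)
  -/(lv 5 (c * l * c^-1)).
move: comm; move: (lv 0%N s0) (lv 1%N s0) (lv 2 l^-1) (lv 3 s) (lv 4 s)
  (lv 5 (c * l * c^-1)) => g0 g1 g2 g3 g4 g5 comm.
by rewrite -!(mulgA g2) comm !mulgA.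
Qed.

End Assembly.

Theorem theorem4p14 (R : realType) (X : metricType R) (phi : homeo X)
    (Hphi : Cantor_minimal_system phi) :
  exists i1 i2 i3 : homeo X,
    [/\ [/\ full_group phi i1, full_group phi i2 & full_group phi i3],
        [/\ involution i1, involution i2 & involution i3],
        [/\ clopen (supp i1), clopen (supp i2) & clopen (supp i3)]
      & phi = (i1 * i2 * i3)%g].
Proof. exact: minimal_three_involutions. Qed.
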